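(* There exists a regular local ring $(R,\mathfrak{m}_R)$ of dimension $2$ and a discrete, rank $1$ valuation $\nu$ of the quotient field of $R$ dominating $R$, such that the function $n\mapsto \ell_R(R/I_n)$ cannot be written as a quasi-polynomial plus a bounded function for large integers $n$.
   Context: A valuation $\nu$ of the quotient field $K$ of $R$ has valuation ring $V_{\nu}=\{f\in K\mid \nu(f)\ge 0\}$ with maximal ideal $\mathfrak{m}_{\nu}=\{f\in K\mid \nu(f)>0\}$; it dominates $R$ if $R\subset V_{\nu}$ and $R\cap\mathfrak{m}_{\nu}=\mathfrak{m}_R$. It is discrete (of rank 1) if its value group is order isomorphic to $\mathbb{Z}$, and the value group is then identified with $\mathbb{Z}$. For $n\in\mathbb{Z}_{\ge 0}$, $I_n=\{f\in R\mid \nu(f)\ge n\}$. $\ell_R$ denotes length as an $R$-module. A quasi-polynomial in $n$ is an expression $a_d(n)n^d+a_{d-1}(n)n^{d-1}+\dots+a_1(n)n+a_0(n)$ whose coefficients $a_0(n),\dots,a_d(n)$ are (real-valued) periodic functions of the integer $n$, with integral period. A function $f$ ''can be written as a quasi-polynomial plus a bounded function for large integers $n$'' if there are a quasi-polynomial $Q(n)$, a bounded function $\sigma(n)$ and an integer $n_0$ with $f(n)=Q(n)+\sigma(n)$ for all integers $n\ge n_0$. *)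

(* Defs.v *)
From HB Require Import structures.
From mathcomp Require Import all_boot all_order all_algebra.
From mathcomp Require Import all_classical all_reals all_analysis.

Set Implicit Arguments.
Unset Strict Implicit.
Unset Printing Implicit Defensive.

Import Order.TTheory GRing.Theory Num.Theory.
Import numFieldNormedType.Exports.

Local Open Scope ring_scope.
Local Open Scope quotient_scope.

(* There is a chain C 0 < C 1 < ... < C l of strict inclusions between sets
   satisfying P; its length l counts the inclusions. *)
Definition has_strict_chain (T : Type) (P : {pred T} -> Prop) (l : nat) :=
  exists C : nat -> {pred T},
    (forall i, (i <= l)%N -> P (C i)) /\
    (forall i, (i < l)%N ->
       {subset C i <= C i.+1} /\ ~ {subset C i.+1 <= C i}).

Definition max_chain_length (T : Type) (P : {pred T} -> Prop) (l : nat) :=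
  has_strict_chain P l /\ forall k, has_strict_chain P k -> (k <= l)%N.

Definition module_length (R : nzRingType) (M : lmodType R) (l : nat) :=
  max_chain_length (fun S : {pred M} => submod_closed S) l.

Definition submod_zmodClosed (R : nzRingType) (M : lmodType R) (S : {pred M})
    (Smod : submod_closed S) : zmodClosed M :=
  let SZ := GRing.isZmodClosed.Build M S (GRing.submod_closedB Smod) in
  HB.pack_for (zmodClosed M) (S : M -> bool) SZ.

Section QuotientModule.
Variables (R : nzRingType) (M : lmodType R) (S : {pred M}).
Hypothesis Smod : submod_closed S.

Definition quot_module := Quotient.quot (submod_zmodClosed Smod).

HB.instance Definition _ := ZmodQuotient.on quot_module.

Definition quot_scale (a : R) (x : quot_module) : quot_module :=
  \pi_quot_module (a *: repr x).

Lemma quot_module_eqE (x y : M) :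
  (\pi_quot_module x == \pi_quot_module y) = (x - y \in S).
Proof. by rewrite (Quotient.idealrBE (submod_zmodClosed Smod)). Qed.

Lemma pi_quot_scale a x :
  \pi_quot_module (a *: x) = quot_scale a (\pi_quot_module x).
Proof.
apply/eqP; rewrite quot_module_eqE -scalerBr.
have /eqP : \pi_quot_module x = \pi_quot_module (repr (\pi_quot_module x)).
  by rewrite reprK.
rewrite quot_module_eqE => xS.
by have [S0 SZ] := Smod; rewrite -[_ *: _]addr0 SZ.
Qed.

Lemma quot_scaleA a b x :
  quot_scale a (quot_scale b x) = quot_scale (a * b) x.
Proof.
by rewrite -[x]reprK -(pi_quot_scale b) -(pi_quot_scale a) -pi_quot_scale scalerA.
Qed.

Lemma quot_scale1 : left_id 1 quot_scale.
Proof. by move=> x; rewrite -[x in LHS]reprK -pi_quot_scale scale1r reprK. Qed.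

Lemma quot_scaleDr : right_distributive quot_scale +%R.
Proof.
move=> a x y; rewrite -[x]reprK -[y]reprK -[_ + _ in LHS]raddfD.
by rewrite -!(pi_quot_scale a) scalerDr raddfD.
Qed.

Lemma quot_scaleDl x : {morph quot_scale^~ x : a b / a + b}.
Proof.
move=> a b; rewrite -[x]reprK.
by rewrite -(pi_quot_scale a) -(pi_quot_scale b) -pi_quot_scale scalerDl raddfD.
Qed.

HB.instance Definition _ := GRing.Zmodule_isLmodule.Build R quot_module
  quot_scaleA quot_scale1 quot_scaleDr quot_scaleDl.

End QuotientModule.

Section CommutativeAlgebra.
Variable R : comNzRingType.
Implicit Types (I J : {pred R}) (s : seq R) (d : nat).

Definition generates s I :=
  forall x, x \in I <->
    exists c : 'I_(size s) -> R, x = \sum_(i < size s) c i * s`_i.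

(* The ideals of R are the submodules of R^o; the unit ideal is included. *)
Definition noetherian :=
  forall I, submod_closed (I : {pred R^o}) -> exists s, generates s I.

(* idealr_closed I includes that I is proper. *)
Definition prime_ideal I := idealr_closed I /\ prime_idealr_closed I.

Definition maximal_ideal I :=
  idealr_closed I /\ forall J, idealr_closed J -> {subset I <= J} -> J =i I.

Definition unique_maximal_ideal I :=
  maximal_ideal I /\ forall J, maximal_ideal J -> J =i I.

Definition krull_dim d := max_chain_length prime_ideal d.

Definition min_number_of_generators I d :=
  (exists s, size s = d /\ generates s I) /\
  forall s, generates s I -> (d <= size s)%N.

Definition regular_local_ring (m : {pred R}) d :=
  [/\ noetherian, unique_maximal_ideal m, krull_dim d
    & min_number_of_generators m d].

End CommutativeAlgebra.

(* A discrete valuation of rank 1, its value group being identified with int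
   (whence val_onto); the value of 0 is +oo. *)
Record discrete_valuation (K : fieldType) := DiscreteValuation {
  val_fun :> K -> \bar int;
  val_zero : val_fun 0 = +oo%E;
  val_fin : forall x, x != 0 -> val_fun x \is a fin_num;
  val_mul : forall x y, val_fun (x * y) = (val_fun x + val_fun y)%E;
  val_add : forall x y,
    (Order.min (val_fun x) (val_fun y) <= val_fun (x + y))%E;
  val_onto : forall k : int, exists x, val_fun x = k%:E
}.

Definition valuation_ring (K : fieldType) (nu : discrete_valuation K) :
  {pred K} := [pred f | (0 <= nu f)%E].

Definition valuation_max_ideal (K : fieldType) (nu : discrete_valuation K) :
  {pred K} := [pred f | (0 < nu f)%E].

Section ValuationIdeals.
Variables (R : idomainType) (nu : discrete_valuation {fraction R}).

Definition dominates (m : {pred R}) :=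
  (forall f : R, tofrac f \in valuation_ring nu) /\
  (forall f : R, f \in m <-> tofrac f \in valuation_max_ideal nu).

Definition valuation_ideal (n : nat) : {pred R^o} :=
  [pred f : R | (n%:Z%:E <= nu (tofrac f))%E].

Lemma valuation_ideal_submod (m : {pred R}) (nuR : dominates m) (n : nat) :
  submod_closed (valuation_ideal n).
Proof.
split=> [|a u v]; rewrite !inE; first by rewrite tofrac0 val_zero leey.
move=> nu_u nu_v; rewrite tofracD; apply: le_trans (val_add nu _ _).
rewrite le_min nu_v andbT tofracM val_mul.
by rewrite -[leLHS]add0e; apply: leeD => //; have := nuR.1 a; rewrite inE.
Qed.

End ValuationIdeals.

Section QuasiPolynomials.
Variable F : realType.

Definition quasi_polynomial (Q : int -> F) :=
  exists (d : nat) (a : 'I_d.+1 -> int -> F),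
    (forall i, exists2 p : int, 0 < p & periodic (a i) p) /\
    (forall n : int, Q n = \sum_(i < d.+1) a i n * n%:~R ^+ i).

Definition eventually_quasi_polynomial_plus_bounded (f : nat -> F) :=
  exists (Q : int -> F) (sigma : nat -> F) (n0 : nat),
    [/\ quasi_polynomial Q, bounded_fun sigma
      & forall n : nat, (n0 <= n)%N -> f n = Q n%:Z + sigma n].

End QuasiPolynomials.

(* Main.v *)
Require Import Defs.
From HB Require Import structures.
From mathcomp Require Import all_boot all_order all_algebra.
From mathcomp Require Import all_classical all_reals all_analysis.
From mathcomp Require Import ring lra zify.

(** Let R be the localization of Q[x, y] at the origin and let nu (f) be the order in t of
    f (t, y (t)), where y = \sum_j 2^(1/2^j) t^(e_j) has very rapidly growing exponents. The
    minimal polynomial over Q (x) of a truncation of y takes at y a value whose leading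
    coefficient is in L_(j+1) but not in L_j, where L_j = Q (2^(1/2^j)). Hence the dimensions
    of the quotients I_n / I_(n+1) over Q are unbounded, and l (R / I_n) outgrows every linear
    function. On the other hand only coefficients in L_j matter modulo t^n for n = e_(j+1),
    whence l (R / I_n) <= 2^j n for these n, which is o (n^2). As every integer divides almost
    all e_j, a quasi-polynomial approximating l (R / I_n) up to a bounded function would be
    given on the multiples of its period by one polynomial, of degree at most 1 by the second
    estimate and not so by the first. *)

Set Implicit Arguments.
Unset Strict Implicit.
Unset Printing Implicit Defensive.

Import Order.TTheory GRing.Theory Num.Theory.
Local Open Scope ring_scope.

(** * The fields of iterated square roots of 2 *)

Section RootTower.
Variable F : realType.

(** A leading coefficient outside L_j occurs only from some order on, but it then persists:
    multiplication by x raises the order by one and keeps the leading coefficient. So each level j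
    adds at least one inclusion inside I_n / I_(n+1) for all large n, which makes the length
    superlinear, while delaying the levels keeps it small at the chosen n. The obstacle is that
    e_(j+1) must be large with respect to an annihilator of the preceding truncation, whose size is
    not explicit. A bound is therefore chosen in advance for every polynomial integral over Q[t]
    ([separation]), and the exponents are defined by recursion from it. The power series y is never
    formed: each coefficient of f (t, y (t)) is read off a truncation. Lengths are estimated from
    above by the linear dependence over Q of sufficiently many elements modulo I_n, and from below
    by an explicit chain of ideals. *)

Definition root2 (j : nat) : F := iter j Num.sqrt 2.

Lemma root2_gt0 j : 0 < root2 j.
Proof. by elim: j => [|j IH] /=; rewrite ?sqrtr_gt0. Qed.

Lemma root2_sqr j : root2 j.+1 ^+ 2 = root2 j.
Proof. by rewrite sqr_sqrtr // ltW ?root2_gt0. Qed.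

Fixpoint tower (j : nat) (z : F) : Prop :=
  if j is j'.+1 then
    exists u v, [/\ tower j' u, tower j' v & z = u + v * root2 j]
  else exists q : rat, z = ratr q.

Lemma tower_rat j q : tower j (ratr q).
Proof.
elim: j q => [|j IH] q /=; first by exists q.
exists (ratr q), 0; split=> //; last by rewrite mul0r addr0.
by have := IH 0; rewrite rmorph0.
Qed.

Lemma tower0 j : tower j 0.
Proof. by have := tower_rat j 0; rewrite rmorph0. Qed.

Lemma tower1 j : tower j 1.
Proof. by have := tower_rat j 1; rewrite rmorph1. Qed.

Lemma towerS j z : tower j z -> tower j.+1 z.
Proof. by move=> Lz; exists z, 0; rewrite mul0r addr0; split=> //; apply: tower0. Qed.

Lemma root2_tower j : tower j (root2 j).
Proof.
case: j => [|j]; first by exists 2; rewrite rmorph_nat.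
by exists 0, 1; rewrite mul1r add0r; split=> //; [apply: tower0 | apply: tower1].
Qed.

Lemma towerD j y z : tower j y -> tower j z -> tower j (y + z).
Proof.
elim: j y z => [|j IH] y z /=.
  by move=> [p ->] [q ->]; exists (p + q); rewrite rmorphD.
move=> [u [v [Lu Lv ->]]] [u' [v' [Lu' Lv' ->]]].
exists (u + u'), (v + v'); split; [exact: IH | exact: IH |].
by rewrite mulrDl addrACA.
Qed.

Lemma towerM j y z : tower j y -> tower j z -> tower j (y * z).
Proof.
elim: j y z => [|j IH] y z.
  by move=> [p ->] [q ->]; exists (p * q); rewrite rmorphM.
move=> [u [v [Lu Lv ->]]] [u' [v' [Lu' Lv' ->]]].
exists (u * u' + v * v' * root2 j), (u * v' + v * u'); split.
- by apply: towerD; [exact: IH | apply: (IH) (root2_tower j); exact: IH].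
- by apply: towerD; apply: IH.
- by rewrite -(root2_sqr j); ring.
Qed.

Lemma towerN j z : tower j z -> tower j (- z).
Proof.
move=> Lz; rewrite -mulN1r; apply: towerM => //.
by have := tower_rat j (-1); rewrite rmorphN1.
Qed.

Lemma tower_sum j (I : Type) (r : seq I) (P : pred I) (f : I -> F) :
  (forall i, P i -> tower j (f i)) -> tower j (\sum_(i <- r | P i) f i).
Proof. by move=> Lf; apply: big_ind => //; [exact: tower0 | exact: towerD]. Qed.

Lemma sqrt2_irrational (q : rat) : (ratr q : F) ^+ 2 != 2.
Proof.
apply/negP => /eqP q2.
have {q2} : q ^+ 2 = 2.
  by apply: (fmorph_inj (@ratr F)); rewrite rmorphXn q2 rmorph_nat.
rewrite -[q]divq_num_den; have := denq_neq0 q; move: (numq q) (denq q) => a b b0.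
have bQ : b%:Q ^+ 2 != 0 by rewrite expf_neq0 // intr_eq0.
move=> /(congr1 (fun x => x * b%:Q ^+ 2)); rewrite expr_div_n divfK //.
rewrite -!(rmorphXn (intr : int -> rat)) -(intrM _ 2) => /intr_inj /(congr1 absz).
rewrite abszX abszM abszX -[`|2|%N]/2%N => ab.
have a0 : (0 < `|a|)%N.
  have: (0 < `|a| ^ 2)%N by rewrite ab muln_gt0 expn_gt0 absz_gt0 b0.
  by rewrite expn_gt0 orbF.
(* In a^2 = 2 b^2 the exponent of the prime 2 is even on the left and odd on the right. *)
have := congr1 (logn 2) ab.
rewrite lognX lognM ?expn_gt0 ?absz_gt0 ?b0 // lognX (@logn_prime 2 2) //=.
by move/(congr1 odd); rewrite oddD !oddM.
Qed.

Lemma towerV j z : tower j z -> tower j z^-1.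
Proof.
elim: j z => [|j IH] z; first by move=> [q ->]; exists q^-1; rewrite fmorphV.
have [->|z0] := eqVneq z 0; first by rewrite invr0.
move=> [u [v [Lu Lv zE]]].
(* The inverse is found by means of the conjugate of [z]. Its vanishing is treated apart, because
   [root2_notin_tower], which would exclude it, itself relies on [towerV]. *)
have [uE|u_neq] := eqVneq u (v * root2 j.+1).
  have -> : z^-1 = 2^-1 * u^-1 by rewrite zE -uE -mulr2n -[u *+ 2]mulr_natl invfM.
  apply: towerS; apply: towerM (IH _ Lu).
  by have := tower_rat j 2^-1; rewrite fmorphV rmorph_nat.
have N_neq0 : u ^+ 2 - v ^+ 2 * root2 j != 0.
  rewrite -(root2_sqr j) -exprMn subr_sqr mulf_neq0 ?subr_eq0 //.
  by rewrite -zE.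
have LN : tower j (u ^+ 2 - v ^+ 2 * root2 j)^-1.
  apply/IH/towerD; rewrite ?expr2; first exact: towerM.
  by apply/towerN/towerM; [exact: towerM | exact: root2_tower].
exists (u * (u ^+ 2 - v ^+ 2 * root2 j)^-1),
  (- v * (u ^+ 2 - v ^+ 2 * root2 j)^-1).
split; [exact: towerM | by apply: towerM => //; exact: towerN |].
apply: (mulfI z0); rewrite divff // zE; set n := _^-1.
transitivity ((u ^+ 2 - v ^+ 2 * root2 j) * n); first by rewrite divff.
by rewrite -(root2_sqr j); ring.
Qed.

(* Squaring [root2 j.+2 = u + v * root2 j.+1] and comparing the components in
   [L_j + L_j * root2 j.+1] gives [u ^+ 2 + v ^+ 2 * root2 j = 0], absurd over the reals. *)
Lemma root2_notin_tower j : ~ tower j (root2 j.+1).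
Proof.
elim: j => [|j IH].
  by move=> [q eq]; have := sqrt2_irrational q; rewrite -eq root2_sqr eqxx.
move=> [u [v [Lu Lv eq]]].
have sq : root2 j.+1 * (1 - 2 * u * v) = u ^+ 2 + v ^+ 2 * root2 j.
  by rewrite -(root2_sqr j) mulrBr mulr1 -{1}(root2_sqr j.+1) eq; ring.
have [uv1|uv_neq] := eqVneq (2 * u * v) 1.
  move: sq; rewrite uv1 subrr mulr0 => /esym/eqP.
  have v2_ge0 : 0 <= v ^+ 2 * root2 j by rewrite mulr_ge0 ?sqr_ge0 // ltW // root2_gt0.
  rewrite paddr_eq0 ?sqr_ge0 //.
  rewrite sqrf_eq0 => /andP[/eqP u0 _].
  by move: uv1; rewrite u0 mulr0 mul0r => /esym/eqP; rewrite oner_eq0.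
apply: IH; have -> : root2 j.+1 = (u ^+ 2 + v ^+ 2 * root2 j) * (1 - 2 * u * v)^-1.
  by rewrite -sq mulfK // subr_eq0 eq_sym.
rewrite !expr2; have L2 : tower j 2 by have := tower_rat j 2; rewrite rmorph_nat.
apply: towerM; last apply: towerV.
  by apply: towerD; do ?apply: towerM => //; apply: root2_tower.
by apply: towerD; [exact: tower1 | apply: towerN; do ?apply: towerM].
Qed.

(** The family doubles at each level through multiplication by [root2 j.+1]. Its size is the factor
    2^j in the upper bound for the length. *)
Lemma tower_span j : exists w : 'I_(2 ^ j) -> F,
  forall z, tower j z -> exists c : 'I_(2 ^ j) -> rat,
    z = \sum_i ratr (c i) * w i.
Proof.
elim: j => [|j [w wP]].
  exists (fun=> 1) => z [q ->]; exists (fun=> q).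
  by rewrite expn0 big_ord1 mulr1.
have e2 : (2 ^ j.+1 = 2 ^ j + 2 ^ j)%N by rewrite expnS mul2n addnn.
rewrite e2; exists (fun i : 'I_(2 ^ j + 2 ^ j) => match fintype.split i with
  inl i => w i | inr i => w i * root2 j.+1 end) => z [u [v [/wP[c ->] /wP[d ->] ->]]].
exists (fun i : 'I_(2 ^ j + 2 ^ j) => match fintype.split i with inl i => c i | inr i => d i end).
rewrite big_split_ord mulr_suml; congr (_ + _); apply: eq_bigr => i _.
  by rewrite (unsplitK (inl _ i)).
by rewrite (unsplitK (inr _ i)) mulrA.
Qed.

Lemma root2_exp j : root2 j ^+ (2 ^ j) = 2.
Proof. by elim: j => // j IH; rewrite expnS exprM root2_sqr. Qed.

End RootTower.

(** * Hilbert's basis theorem *)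

Section IdealSpan.
Variable R : comNzRingType.

Definition ideal_span (s : seq R) (x : R) : Prop :=
  exists c : 'I_(size s) -> R, x = \sum_(i < size s) c i * s`_i.

Lemma ideal_span0 s : ideal_span s 0.
Proof. by exists (fun=> 0); rewrite big1 // => i _; rewrite mul0r. Qed.

Lemma ideal_spanD s x y : ideal_span s x -> ideal_span s y -> ideal_span s (x + y).
Proof.
move=> [c ->] [d ->]; exists (fun i => c i + d i); rewrite -big_split.
by apply: eq_bigr => i _; rewrite mulrDl.
Qed.

Lemma ideal_spanZ s a x : ideal_span s x -> ideal_span s (a * x).
Proof.
move=> [c ->]; exists (fun i => a * c i); rewrite mulr_sumr.
by apply: eq_bigr => i _; rewrite mulrA.
Qed.

Lemma mem_ideal_span s x : x \in s -> ideal_span s x.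
Proof.
move=> xs; exists (fun i => (i == index x s :> nat)%:R).
have lt_xs : (index x s < size s)%N by rewrite index_mem.
rewrite (bigD1 (Ordinal lt_xs)) //= eqxx mul1r nth_index // big1 ?addr0 //.
move=> i; rewrite -val_eqE /= => /negPf ->; exact: mul0r.
Qed.

Lemma ideal_span_sub s I x : submod_closed (I : {pred R^o}) ->
  {subset s <= I} -> ideal_span s x -> x \in I.
Proof.
move=> [I0 IZ] sI [c ->]; apply: (big_ind (fun y => y \in I)) => [//|y z Iy Iz|i _].
  by rewrite -[y]mul1r; apply: IZ.
by rewrite -[_ * _]addr0; apply: IZ I0; apply/sI/mem_nth.
Qed.

Lemma generates_span s (I : {pred R}) :
  submod_closed (I : {pred R^o}) -> {subset s <= I} ->
  (forall x, x \in I -> ideal_span s x) -> generates s I.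
Proof. by move=> Imod sI Is x; split; [exact: Is | exact: ideal_span_sub]. Qed.

Lemma noetherian_span (I : {pred R}) : noetherian R -> submod_closed (I : {pred R^o}) ->
  exists2 s, {subset s <= I} & forall x, x \in I -> ideal_span s x.
Proof.
move=> noeth Imod; have [s sI] := noeth I Imod; exists s; last by move=> x /sI.
by move=> x xs; apply/sI/mem_ideal_span.
Qed.

Lemma ideal_span_cat s t x : ideal_span t x -> {subset t <= s} -> ideal_span s x.
Proof.
move=> [c ->] ts; apply: (big_ind (ideal_span _)) => [||i _];
  [exact: ideal_span0 | exact: ideal_spanD |].
by apply/ideal_spanZ/mem_ideal_span/ts/mem_nth.
Qed.

End IdealSpan.

Section HilbertBasis.
Variable R : comNzRingType.

(** The degree is only bounded and the coefficient may be 0: this makes the sets ideals, increasing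
    with [d] since multiplication by a power of X shifts coefficients. *)
Definition lead_ideal (I : {pred {poly R}}) (d : nat) : {pred R} :=
  fun a => `[< exists f, [/\ f \in I, (size f <= d.+1)%N & f`_d = a] >].

Lemma lead_ideal_submod I d : submod_closed (I : {pred {poly R}^o}) ->
  submod_closed (lead_ideal I d : {pred R^o}).
Proof.
move=> [I0 IZ]; split.
  by apply/asboolP; exists 0; rewrite size_poly0 coef0.
move=> a u v /asboolP[f [fI fd <-]] /asboolP[g [gI gd <-]].
apply/asboolP; exists (a%:P * f + g); split; first exact: IZ.
  rewrite (leq_trans (size_polyD _ _)) // geq_max gd andbT.
  by rewrite mul_polyC (leq_trans (size_scale_leq _ _)).
by rewrite coefD coefCM.
Qed.

Lemma lead_ideal_le I d e : submod_closed (I : {pred {poly R}^o}) -> (d <= e)%N ->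
  {subset lead_ideal I d <= lead_ideal I e}.
Proof.
move=> [I0 IZ] le_de a /asboolP[f [fI fd <-]]; apply/asboolP.
exists ('X^(e - d) * f); split.
- by rewrite -[_ * _]addr0; apply: (IZ).
- rewrite (leq_trans (size_polyMleq _ _)) // size_polyXn; lia.
- by rewrite coefXnM ltnNge leq_subr /= subKn.
Qed.

Lemma lead_ideal_lift I d : noetherian R -> submod_closed (I : {pred {poly R}^o}) ->
  exists2 t : seq {poly R}, {subset t <= I} &
    forall a, a \in lead_ideal I d ->
      exists g, [/\ ideal_span t g, (size g <= d.+1)%N & g`_d = a].
Proof.
move=> noeth Imod; have [s sI Is] := noetherian_span noeth (lead_ideal_submod d Imod).
have lift a : exists f, a \in s -> [/\ f \in I, (size f <= d.+1)%N & f`_d = a].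
  have [/sI/asboolP[f fP]|_] := boolP (a \in s); first by exists f.
  by exists 0.
have {lift} [h hP] := choice lift.
exists (map h s) => [f /mapP[a /hP[fI _ _] -> //]|a /Is[c ->]].
exists (\sum_(i < size s) (c i)%:P * h s`_i); split.
- apply: (big_ind (ideal_span _)) => [||i _];
  [exact: ideal_span0 | exact: ideal_spanD |].
  by apply/ideal_spanZ/mem_ideal_span/map_f/mem_nth.
- apply: (leq_trans (size_sum _ _ _)); apply/bigmax_leqP => i _.
  rewrite mul_polyC (leq_trans (size_scale_leq _ _)) //.
  by have [] := hP _ (mem_nth 0 (ltn_ord i)).
- rewrite coef_sum; apply: eq_bigr => i _; rewrite coefCM.
  by have [_ _ ->] := hP _ (mem_nth 0 (ltn_ord i)).
Qed.

(** The union over all degrees is an ideal, and its finitely many generators are all present from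
    some degree on. *)
Lemma lead_ideal_stable I : noetherian R -> submod_closed (I : {pred {poly R}^o}) ->
  exists d, forall e, {subset lead_ideal I e <= lead_ideal I d}.
Proof.
move=> noeth Imod.
pose J : {pred R} := fun a => `[< exists d, a \in lead_ideal I d >].
have Jmod : submod_closed (J : {pred R^o}).
  split; first by apply/asboolP; exists 0; case: (lead_ideal_submod 0 Imod).
  move=> a u v /asboolP[d ud] /asboolP[e ve]; apply/asboolP; exists (maxn d e).
  have [_ IZ] := lead_ideal_submod (maxn d e) Imod.
  by apply: IZ; [apply: lead_ideal_le ud => // | apply: lead_ideal_le ve => //];
    rewrite ?leq_maxl ?leq_maxr.
have [s sJ Js] := noetherian_span noeth Jmod.
have [d sd] : exists d, {subset s <= lead_ideal I d}.
  elim: s sJ {Js} => [|a s IH] sJ; first by exists 0%N.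
  have [b bs|d sd] := IH; first by apply: sJ; rewrite inE bs orbT.
  have /asboolP[e ae] := sJ a (mem_head _ _).
  exists (maxn d e) => b; rewrite inE => /orP[/eqP->|/sd bd].
    by apply: lead_ideal_le ae => //; rewrite leq_maxr.
  by apply: lead_ideal_le bd => //; rewrite leq_maxl.
exists d => e a ae; apply: ideal_span_sub (lead_ideal_submod d Imod) sd _.
by apply: Js; apply/asboolP; exists e.
Qed.

Theorem hilbert_basis : noetherian R -> noetherian {poly R}.
Proof.
move=> noeth I Imod; have [I0 IZ] := Imod; have [d0 dP] := lead_ideal_stable noeth Imod.
have gens d : exists s : seq {poly R}, {subset s <= I} /\
    forall a, a \in lead_ideal I d ->
      exists g, [/\ ideal_span s g, (size g <= d.+1)%N & g`_d = a].
  by have [s sI sP] := lead_ideal_lift d noeth Imod; exists s.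
have {gens} [t tP] := choice gens.
pose T := flatten [seq t d | d <- iota 0 d0.+1].
have tT d : (d <= d0)%N -> {subset t d <= T}.
  by move=> dd0 f ft; apply/flatten_mapP; exists d => //; rewrite mem_iota.
exists T; apply: generates_span => // [f /flatten_mapP[d _ /(tP d).1] //|f].
have [n] := ubnP (size f); elim: n f => // n IH f; rewrite ltnS => fn fI.
have [->|f0] := eqVneq f 0; first exact: ideal_span0.
pose e := (size f).-1; have fe : size f = e.+1 by rewrite prednK // lt0n size_poly_eq0.
have flead : f`_e \in lead_ideal I (minn e d0).
  have : f`_e \in lead_ideal I e by apply/asboolP; exists f; rewrite fe.
  by rewrite /minn; case: ltnP => // _ /dP.
have [g [gT gsz gE]] := (tP _).2 _ flead.
have {}gT : ideal_span T g by apply: ideal_span_cat gT _; apply: tT; apply: geq_minr.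
(* The shift of [g] with the leading term of [f]: subtracting it lowers the degree. Beyond degree
   [d0] the generators for [d0] suffice by stability. *)
pose h := 'X^(e - minn e d0) * g.
have hT : ideal_span T h by exact: ideal_spanZ.
have hI : h \in I.
  by apply: ideal_span_sub hT => // b /flatten_mapP[d _ /(tP d).1].
rewrite -(subrK h f); apply: ideal_spanD => //; apply: IH; last first.
  by rewrite addrC -[- h]mulN1r; apply: IZ.
apply: leq_trans fn; rewrite fe ltnS; apply/leq_sizeP => j; rewrite leq_eqVlt.
have hE : h`_e = f`_e by rewrite coefXnM ltnNge leq_subr /= subKn ?geq_minl.
case/orP => [/eqP <-|ej]; first by rewrite coefB hE subrr.
have -> : (f - h)`_j = - h`_j by rewrite coefB nth_default ?fe // sub0r.
rewrite nth_default ?oppr0 // (leq_trans (size_polyMleq _ _)) // size_polyXn.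
by have := geq_minl e d0; lia.
Qed.

End HilbertBasis.

Lemma field_noetherian (k : fieldType) : noetherian k.
Proof.
move=> I Imod; have [I0 IZ] := Imod.
have [[a aI a0]|none] := pselect (exists2 a, a \in I & a != 0).
  exists [:: a]; apply: generates_span => // [b|x xI].
    by rewrite inE => /eqP ->.
  by exists (fun=> x / a); rewrite big_ord1 divfK.
exists [::]; apply: generates_span => // x xI.
have [->|x0] := eqVneq x 0; first exact: ideal_span0.
by case: none; exists x.
Qed.

(** * Localization at the kernel of a morphism to a field *)

Section LocalizationAtKernel.
Variables (A : idomainType) (k : fieldType) (eps : {rmorphism A -> k}).

(** The kernel of [eps] is prime because [k] is a field. Inside the fraction field, equality of
    fractions and integrality are inherited. *)
Definition loc_pred : {pred {fraction A}} :=
  fun z => `[< exists a b, eps b != 0 /\ z = tofrac a / tofrac b >].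

Lemma loc_denom_neq0 b : eps b != 0 -> tofrac b != 0 :> {fraction A}.
Proof. by apply: contra_neq => /eqP; rewrite tofrac_eq0 => /eqP ->; rewrite rmorph0. Qed.

Lemma loc_subring_closed : subring_closed loc_pred.
Proof.
split.
- apply/asboolP; exists 1, 1; rewrite !rmorph1 oner_neq0.
  by split=> //; rewrite divr1.
- move=> _ _ /asboolP[a [b [b0 ->]]] /asboolP[c [d [d0 ->]]]; apply/asboolP.
  exists (a * d - c * b), (b * d); rewrite rmorphM mulf_neq0 //; split=> //.
  have b0' := loc_denom_neq0 b0; have d0' := loc_denom_neq0 d0.
  by rewrite -mulNr addf_div // mulNr -!rmorphM -rmorphB.
- move=> _ _ /asboolP[a [b [b0 ->]]] /asboolP[c [d [d0 ->]]]; apply/asboolP.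
  exists (a * c), (b * d); rewrite rmorphM mulf_neq0 //; split=> //.
  by rewrite !rmorphM mulf_div.
Qed.

Record localization := Localization { loc_val : {fraction A}; _ : loc_val \in loc_pred }.

HB.instance Definition _ := [isSub for loc_val].
HB.instance Definition _ := [Choice of localization by <:].
HB.instance Definition _ :=
  GRing.SubChoice_isSubComNzRing.Build {fraction A} loc_pred localization
    loc_subring_closed.

Definition loc_unit : {pred localization} := fun z => `[< exists y, y * z = 1 >].

Definition loc_inv (z : localization) : localization :=
  if pselect (exists y, y * z = 1) is left ex then projT1 (cid ex) else z.

Lemma loc_mulVx : {in loc_unit, left_inverse 1 loc_inv *%R}.
Proof.
move=> z /asboolP ex; rewrite /loc_inv; case: pselect => // ex'.
by case: cid.
Qed.

Lemma loc_unitPl (x y : localization) : y * x = 1 -> loc_unit x.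
Proof. by move=> yx; apply/asboolP; exists y. Qed.

Lemma loc_inv_out : {in [predC loc_unit], loc_inv =1 id}.
Proof.
by move=> z /asboolP nex; rewrite /loc_inv; case: pselect.
Qed.

HB.instance Definition _ := GRing.ComNzRing_hasMulInverse.Build localization
  loc_mulVx loc_unitPl loc_inv_out.

Lemma loc_integral : GRing.integral_domain_axiom localization.
Proof.
move=> x y /(congr1 val) /eqP; rewrite rmorphM rmorph0 mulf_eq0.
by rewrite -!(rmorph0 (val : localization -> _)) !(inj_eq val_inj).
Qed.

HB.instance Definition _ := GRing.ComUnitRing_isIntegral.Build localization loc_integral.

Lemma loc_embed_subproof a : tofrac a \in loc_pred.
Proof.
by apply/asboolP; exists a, 1; rewrite !rmorph1 oner_neq0 divr1.
Qed.

Definition loc_embed (a : A) : localization := Localization (loc_embed_subproof a).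

Lemma loc_embed_zmod : zmod_morphism loc_embed.
Proof. by move=> a b; apply: val_inj; rewrite rmorphB /= rmorphB. Qed.

Lemma loc_embed_monoid : monoid_morphism loc_embed.
Proof.
by split=> [|a b]; apply: val_inj; rewrite ?rmorph1 ?rmorphM /= ?rmorph1 ?rmorphM.
Qed.

HB.instance Definition _ := GRing.isZmodMorphism.Build A localization loc_embed
  loc_embed_zmod.
HB.instance Definition _ := GRing.isMonoidMorphism.Build A localization loc_embed
  loc_embed_monoid.

Lemma loc_embed_inj : injective loc_embed.
Proof. by move=> a b /(congr1 val) /eqP; rewrite /= tofrac_eq => /eqP. Qed.

Lemma loc_embed_unit b : eps b != 0 -> loc_embed b \is a GRing.unit.
Proof.
move=> b0; have vb : (tofrac b)^-1 \in loc_pred.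
  by apply/asboolP; exists 1, b; rewrite rmorph1 div1r.
apply/unitrPr; exists (Localization vb); apply: val_inj.
by rewrite rmorphM rmorph1 /= divff // loc_denom_neq0.
Qed.

Lemma locP z : exists a b, eps b != 0 /\ z * loc_embed b = loc_embed a.
Proof.
case: z => z zP; have /asboolP[a [b [b0 zE]]] := zP; exists a, b; split=> //.
by apply: val_inj; rewrite rmorphM /= zE divfK // loc_denom_neq0.
Qed.

End LocalizationAtKernel.

Section LocalizationTheory.
Variables (A : idomainType) (k : fieldType) (eps : {rmorphism A -> k}).
Local Notation R := (localization eps).
Local Notation iota := (loc_embed eps).
Implicit Types (z w : R) (a b : A).

(** Denominators are units, so an ideal is determined by the numerators in it; this reduces
    questions about the localization to [A]. *)
Lemma loc_mem (J : {pred R}) z a b : submod_closed (J : {pred R^o}) ->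
  eps b != 0 -> z * iota b = iota a -> (z \in J) = (iota a \in J).
Proof.
move=> [J0 JZ] b0 zE; apply/idP/idP => [zJ|aJ].
  rewrite -zE mulrC -[_ * _]addr0; exact: (JZ (iota b) z 0).
have bU := loc_embed_unit b0.
have -> : z = (iota b)^-1 * iota a by rewrite -zE mulrC mulrK.
by rewrite -[_ * _]addr0; apply: JZ.
Qed.

Lemma loc_noetherian : noetherian A -> noetherian R.
Proof.
move=> noeth J Jmod; have [J0 JZ] := Jmod.
pose I : {pred A} := fun a => iota a \in J.
have Imod : submod_closed (I : {pred A^o}).
  split=> [|a u v]; rewrite !unfold_in ?rmorph0 // => uI vI.
  by rewrite rmorphD rmorphM; apply: JZ.
have [s sI Is] := noetherian_span noeth Imod.
exists (map iota s); apply: generates_span => // [_ /mapP[a /sI aI ->] //|z zJ].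
have [a [b [b0 zE]]] := locP z.
have /Is[c aE] : a \in I by rewrite unfold_in -(loc_mem Jmod b0 zE).
have -> : z = (iota b)^-1 * iota a by rewrite -zE mulrC mulrK ?loc_embed_unit.
apply: ideal_spanZ; rewrite aE rmorph_sum.
apply: (big_ind (ideal_span _)) => [||i _];
  [exact: ideal_span0 | exact: ideal_spanD |].
by rewrite rmorphM; apply/ideal_spanZ/mem_ideal_span/map_f/mem_nth.
Qed.

Definition loc_max : {pred R} := [pred z | z \isn't a GRing.unit].

Lemma loc_unitE z a b : eps b != 0 -> z * iota b = iota a ->
  (z \is a GRing.unit) = (eps a != 0).
Proof.
move=> b0 zE; apply/idP/idP => [/unitrPr[y zy]|a0]; last first.
  by have := loc_embed_unit a0; rewrite -zE unitrM => /andP[].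
have [c [d [d0 yE]]] := locP y.
have : b * d = a * c.
  by apply: (@loc_embed_inj _ _ eps); rewrite !rmorphM /= -zE -yE mulrACA zy mul1r.
move/(congr1 eps); rewrite !rmorphM => bd.
by have := mulf_neq0 b0 d0; rewrite bd mulf_eq0 negb_or => /andP[].
Qed.

Lemma loc_max_embed a : (iota a \in loc_max) = (eps a == 0).
Proof.
have e1 : eps 1 != 0 by rewrite rmorph1 oner_neq0.
by rewrite inE (loc_unitE (a := a) e1) ?rmorph1 ?mulr1 // negbK.
Qed.

Lemma loc_max_ideal : idealr_closed loc_max.
Proof.
split; rewrite ?inE ?unitr0 ?unitr1 // => r u v; rewrite !inE.
have [a [b [b0 uE]]] := locP u; have [c [d [d0 vE]]] := locP v.
have [e [f [f0 rE]]] := locP r.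
rewrite (loc_unitE b0 uE) (loc_unitE d0 vE) !negbK => /eqP a0 /eqP c0.
rewrite (@loc_unitE _ (e * a * d + c * f * b) (f * b * d)).
- by rewrite rmorphD !rmorphM a0 c0 mulr0 !mul0r addr0 negbK.
- by rewrite !rmorphM !mulf_neq0.
- by rewrite !(rmorphD, rmorphM) /= -uE -vE -rE; ring.
Qed.

Lemma proper_sub_loc_max (J : {pred R}) : idealr_closed J -> {subset J <= loc_max}.
Proof.
move=> [J0 /negP J1 JZ] z zJ; apply/negP => /unitrPr[y zy]; case: J1.
by rewrite -zy mulrC -[_ * _]addr0; apply: JZ.
Qed.

Lemma loc_unique_max : unique_maximal_ideal loc_max.
Proof.
have maxm : maximal_ideal loc_max.
  split=> [|J /proper_sub_loc_max Jm mJ z]; first exact: loc_max_ideal.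
  by apply/idP/idP => [/Jm|/mJ].
split=> // J [Jid Jmax] z.
by rewrite -(Jmax _ loc_max_ideal (proper_sub_loc_max Jid)).
Qed.

Lemma loc_max_prime : prime_ideal loc_max.
Proof.
split; first exact: loc_max_ideal.
by move=> u v; rewrite !inE unitrM negb_and.
Qed.

Lemma idealr_closed_submod (I : {pred R}) : idealr_closed I -> submod_closed (I : {pred R^o}).
Proof. by move=> [I0 _ IZ]; split. Qed.

End LocalizationTheory.
Arguments loc_max {A k} eps.

(** * The local ring of the plane at the origin *)

Section RegularLocalRing.
Variable k : fieldType.
Local Notation A := {poly {poly k}}.

Definition origin : {rmorphism A -> k} :=
  (horner_eval (0 : k) \o horner_eval (0 : {poly k})).
Definition mod_x : {rmorphism A -> {poly k}} := map_poly (horner_eval (0 : k)).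

Local Notation R := (localization origin).
Local Notation iota := (loc_embed origin).
Local Notation x := ('X%:P : A).
Local Notation y := ('X : A).

Lemma originE (f : A) : origin f = f.[0].[0]. Proof. by []. Qed.

Lemma origin_mod_x f : (mod_x f).[0] = origin f.
Proof.
by rewrite originE !horner_coef0 coef_map /= /horner_eval horner_coef0.
Qed.

Lemma mod_x_neq0 f : origin f != 0 -> mod_x f != 0.
Proof. by apply: contra_neq => fx; rewrite -origin_mod_x fx horner0. Qed.

Lemma mod_xx : mod_x x = 0.
Proof. by rewrite /= map_polyC /= /horner_eval hornerX polyC0. Qed.

Lemma mod_xy : mod_x y = 'X.
Proof. by rewrite /= map_polyX. Qed.

Lemma dvdX_root0 (c : {poly k}) : c.[0] = 0 -> exists c', c = 'X * c'.
Proof.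
move=> c0; have /factor_theorem[c' ->] : root c 0 by apply/eqP.
by exists c'; rewrite subr0 mulrC.
Qed.

(** Modulo x the local ring is a discrete valuation ring with uniformizer y: there [f] is zero or a
    power of y times a unit. *)
Lemma local_dichotomy (f : A) : (exists g, f = x * g) \/
  exists g n U, origin U != 0 /\ f = x * g + y ^+ n * U.
Proof.
elim/poly_ind: f => [|f c IH]; first by left; exists 0; rewrite mulr0.
have [c0|c0] := eqVneq c.[0] 0; last first.
  right; exists 0, 0%N, (f * y + c%:P).
  by rewrite originE hornerMXaddC mulr0 !add0r mulr0 add0r expr0 mul1r; split.
have [c' ->] := dvdX_root0 c0; case: IH => [[g ->]|[g [n [U [U0 ->]]]]].
  by left; exists (g * y + c'%:P); rewrite polyCM; ring.
right; exists (g * y + c'%:P), n.+1, U; split=> //.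
by rewrite polyCM exprS; ring.
Qed.

Lemma mod_x_dvd f : mod_x f = 0 -> exists g, f = x * g.
Proof.
case: (local_dichotomy f) => // -[g [n [U [U0 ->]]]].
rewrite rmorphD !rmorphM rmorphXn [mod_x x]mod_xx mul0r add0r mod_xy => /eqP.
by rewrite mulf_eq0 expf_eq0 polyX_eq0 andbF (negPf (mod_x_neq0 U0)).
Qed.

Lemma origin0_gen f : origin f = 0 -> exists g h, f = x * g + y * h.
Proof.
elim/poly_ind: f => [|f c _]; first by exists 0, 0; rewrite !mulr0 addr0.
rewrite originE hornerMXaddC mulr0 add0r => /dvdX_root0[c' ->].
by exists c'%:P, f; rewrite polyCM; ring.
Qed.

Definition x_ideal : {pred R} := fun z => `[< exists w, z = iota x * w >].

Lemma x_idealE z a b : origin b != 0 -> z * iota b = iota a ->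
  (z \in x_ideal) = (mod_x a == 0).
Proof.
move=> b0 zE; apply/asboolP/eqP => [[w wE]|/mod_x_dvd[g aE]].
  have [c [d [d0 wE']]] := locP w.
  have : a * d = x * c * b.
    by apply: (@loc_embed_inj _ _ origin); rewrite !rmorphM /= -zE wE -wE'; ring.
  move/(congr1 mod_x); rewrite !rmorphM [mod_x x]mod_xx !mul0r => /eqP.
  by rewrite mulf_eq0 (negPf (mod_x_neq0 d0)) orbF => /eqP.
exists (iota g * (iota b)^-1); apply: (mulIr (loc_embed_unit b0)).
by rewrite zE aE rmorphM /= mulrA mulrVK ?loc_embed_unit.
Qed.

Lemma x_ideal_embed a : (iota a \in x_ideal) = (mod_x a == 0).
Proof.
have e1 : origin 1 != 0 by rewrite rmorph1 oner_neq0.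
by rewrite (x_idealE (a := a) e1) ?rmorph1 ?mulr1.
Qed.

Lemma x_ideal_prime : prime_ideal x_ideal.
Proof.
split; first split.
- by apply/asboolP; exists 0; rewrite mulr0.
- by rewrite -(rmorph1 iota) x_ideal_embed rmorph1 oner_neq0.
- move=> r _ _ /asboolP[u ->] /asboolP[v ->]; apply/asboolP.
  by exists (r * u + v); ring.
move=> u v; have [a [b [b0 uE]]] := locP u; have [c [d [d0 vE]]] := locP v.
rewrite (x_idealE b0 uE) (x_idealE d0 vE) (@x_idealE _ (a * c) (b * d)).
- by rewrite rmorphM mulf_eq0.
- by rewrite rmorphM mulf_neq0.
- by rewrite !rmorphM /= -uE -vE mulrACA.
Qed.

Lemma ideal_mul (I : {pred R}) r u : idealr_closed I -> u \in I -> r * u \in I.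
Proof. by move=> [I0 _ IZ] uI; rewrite -[_ * _]addr0; apply: IZ. Qed.

Lemma ideal_add (I : {pred R}) u v : idealr_closed I -> u \in I -> v \in I -> u + v \in I.
Proof. by move=> [_ _ IZ] uI vI; rewrite -[u]mul1r; apply: IZ. Qed.

Lemma ideal_origin (I : {pred R}) a : idealr_closed I -> iota a \in I -> origin a = 0.
Proof. by move=> Iid /(proper_sub_loc_max Iid); rewrite loc_max_embed => /eqP. Qed.

Lemma ideal_xy (I : {pred R}) : idealr_closed I -> iota x \in I -> iota y \in I ->
  {subset loc_max origin <= I}.
Proof.
move=> Iid xI yI z zm; have [a [b [b0 zE]]] := locP z.
have Imod := idealr_closed_submod Iid.
have mmod := idealr_closed_submod (loc_max_ideal origin).
rewrite (loc_mem Imod b0 zE); move: zm; rewrite (loc_mem mmod b0 zE) loc_max_embed.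
move=> /eqP /origin0_gen[g [h ->]]; rewrite rmorphD !rmorphM.
by apply: ideal_add => //; rewrite mulrC; apply: ideal_mul.
Qed.

Lemma prime_X (P : {pred R}) u n : prime_ideal P -> u ^+ n \in P -> u \in P.
Proof.
move=> [[P0 P1 PZ] Pp]; elim: n => [|n IH]; first by rewrite (negPf P1).
by rewrite exprS => /Pp /orP[].
Qed.

(** In the local ring a nonzero element of k[x] is a power of x times a unit. *)
Lemma prime_constant (P : {pred R}) (c : {poly k}) :
  prime_ideal P -> c != 0 -> iota c%:P \in P -> iota x \in P.
Proof.
move=> Pprime; have [Pid Pp] := Pprime.
have [n] := ubnP (size c); elim: n c => // n IH c; rewrite ltnS => cn c0 cP.
have /dvdX_root0[c' cE] : c.[0] = 0.
  by have := ideal_origin Pid cP; rewrite originE hornerC.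
have c'0 : c' != 0 by apply: contra_neq c0 => c'0; rewrite cE c'0 mulr0.
move: cP; rewrite cE polyCM rmorphM => /Pp /orP[//|]; apply: IH => //.
by apply: leq_trans cn; rewrite cE mulrC size_mulX.
Qed.

(* Over the fraction field of k[x] two distinct nonzero primes are comaximal; clearing
   denominators in a Bezout relation puts a nonzero element of k[x] in the larger one. *)
Lemma x_in_second_prime (P Q : {pred R}) : prime_ideal P -> prime_ideal Q ->
  {subset P <= Q} -> ~ {subset Q <= P} -> (exists2 z, z \in P & z != 0) ->
  iota x \in Q.
Proof.
move=> Pprime Qprime PQ nQP [z zP z0]; have [Pid Pp] := Pprime; have [Qid Qp] := Qprime.
have numer (I : {pred R}) v : idealr_closed I ->
    exists b a, [/\ origin b != 0, v * iota b = iota a & (v \in I) = (iota a \in I)].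
  move=> Iid; have [a [b [b0 vE]]] := locP v; exists b, a; split=> //.
  exact: loc_mem (idealr_closed_submod Iid) b0 vE.
have exf : exists n, `[< exists f : A, [/\ iota f \in P, f != 0 & size f = n] >].
  have [b [f [b0 fE zf]]] := numer P z Pid; exists (size f); apply/asboolP.
  exists f; split; rewrite ?zf // -?zf //.
  apply: contra_neq z0 => f0; apply: (mulIr (loc_embed_unit b0)).
  by rewrite fE f0 rmorph0 mul0r.
have [_ /asboolP[f [fP f0 <-]] fmin] := ex_minnP exf.
have [g [gQ gP]] : exists g, iota g \in Q /\ iota g \notin P.
  have [v vQ vP] : exists2 v, v \in Q & v \notin P.
    apply: contrapT => no; apply: nQP => v vQ; apply: contrapT => /negP vP.
    by apply: no; exists v.
  have [b [g [b0 gE vg]]] := numer P v Pid; exists g; rewrite -vg; split=> //.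
  by rewrite -gE mulrC; apply: ideal_mul.
(* Pseudo-division introduces scalars from k[x]; a prime without x allows them to be cancelled. *)
have const (c : {poly k}) h (I : {pred R}) : prime_ideal I -> iota x \notin I ->
    c != 0 -> iota (c *: h) \in I -> iota h \in I.
  move=> Iprime xI c0; rewrite -mul_polyC rmorphM => /(Iprime.2) /orP[cI|//].
  by move: xI; rewrite (prime_constant Iprime c0 cI).
apply: contrapT => /negP xQ.
have xP : iota x \notin P by apply: contraNN xQ; apply: PQ.
have /Pdiv.Idomain.dvdpP[[c e] /= c0 fE] := dvdp_gcdl f g.
have /Pdiv.Idomain.dvdpP[[c' e'] /= c'0 gE] := dvdp_gcdr f g.
have dP : iota (gcdp f g) \notin P.
  apply: contraNN gP => dP; apply: const xP c'0 _ => //.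
  by rewrite gE rmorphM; apply: ideal_mul.
have eP : iota e \in P.
  have : iota (c *: f) \in P by rewrite -mul_polyC rmorphM; apply: ideal_mul.
  by rewrite fE rmorphM => /Pp; rewrite (negPf dP) orbF.
have e0 : e != 0.
  apply: contraNneq f0 => e0; move: fE; rewrite e0 mul0r => /eqP.
  by rewrite -mul_polyC mulf_eq0 polyC_eq0 (negPf c0).
have d0 : gcdp f g != 0 by rewrite gcdp_eq0 negb_and f0.
(* As [e] is a nonzero element of [P], minimality of [f] leaves only degree 0 in y for the gcd. *)
have size_d : size (gcdp f g) = 1%N.
  have size_e : (size f <= size e)%N by apply: fmin; apply/asboolP; exists e.
  have : size f = (size e + size (gcdp f g)).-1 by rewrite -(size_scale f c0) fE size_mul.
  move: size_e; have : (0 < size (gcdp f g))%N by rewrite size_poly_gt0.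
  by clear; case: (size (gcdp f g)) => [|[|n]] // _; case: (size e) => [|m] /=; lia.
have [[u v] /eqp_size] := Bezoutp f g; rewrite size_d /=.
move/eqP/size_poly1P => [d d_neq0 dE]; move/negP: xQ; apply.
apply: (prime_constant Qprime d_neq0); rewrite -dE rmorphD !rmorphM.
by apply: ideal_add => //; apply: ideal_mul => //; apply: PQ.
Qed.

Lemma y_in_prime (P : {pred R}) (f : A) : prime_ideal P ->
  iota x \in P -> iota f \in P -> mod_x f != 0 -> iota y \in P.
Proof.
move=> Pprime xP fP fx; have [Pid Pp] := Pprime.
case: (local_dichotomy f) fP fx => [[g ->]|[g [n [U [U0 ->]]]] fP _].
  by rewrite [mod_x (_ * _)]rmorphM [mod_x x]mod_xx mul0r eqxx.
have : iota (y ^+ n * U) \in P.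
  have -> : y ^+ n * U = - g * x + (x * g + y ^+ n * U) by ring.
  by rewrite rmorphD rmorphM; apply: ideal_add => //; apply: ideal_mul.
rewrite rmorphM rmorphXn => /Pp /orP[/(prime_X Pprime) //|/(ideal_origin Pid)/eqP].
by rewrite (negPf U0).
Qed.

(** Factors x are divided out of [f]; the quotient stays in [P] by primality, and the process stops
    because the degree in x of the leading coefficient drops. *)
Lemma prime_mod_x_neq0 (P : {pred R}) (f : A) : prime_ideal P -> iota x \notin P ->
  f != 0 -> iota f \in P -> exists2 g, iota g \in P & mod_x g != 0.
Proof.
move=> Pprime xP; have [n] := ubnP (size (lead_coef f)).
elim: n f => // n IH f; rewrite ltnS => fn f0 fP.
have [/mod_x_dvd[g fE]|fx] := eqVneq (mod_x f) 0; last by exists f.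
have g0 : g != 0 by apply: contraNneq f0 => g0; rewrite fE g0 mulr0.
apply: (IH g) => //.
  apply: leq_trans fn; rewrite fE lead_coefM lead_coefC mulrC size_mulX //.
  by rewrite lead_coef_eq0.
by move: fP; rewrite fE rmorphM => /(Pprime.2) /orP[xP'|//]; rewrite xP' in xP.
Qed.

(** Once x is in [Q], an element of [Q] that does not vanish modulo x brings in y. It comes from [Q]
    outside [P] if x is in [P], and otherwise from [P] after division by powers of x. *)
Lemma second_prime_max (P Q : {pred R}) : prime_ideal P -> prime_ideal Q ->
  {subset P <= Q} -> ~ {subset Q <= P} -> (exists2 z, z \in P & z != 0) ->
  {subset loc_max origin <= Q}.
Proof.
move=> Pprime Qprime PQ nQP Pn0; have xQ := x_in_second_prime Pprime Qprime PQ nQP Pn0.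
have [Pid Pp] := Pprime; have [Qid Qp] := Qprime.
apply: ideal_xy => //.
have [xP|xP] := boolP (iota x \in P).
  have [v vQ vP] : exists2 v, v \in Q & v \notin P.
    apply: contrapT => no; apply: nQP => v vQ; apply: contrapT => /negP vP.
    by apply: no; exists v.
  have [a [b [b0 vE]]] := locP v.
  apply: (@y_in_prime Q a) => //; first by rewrite -vE mulrC; apply: ideal_mul.
  rewrite -(x_idealE b0 vE); apply: contraNN vP => /asboolP[w ->].
  by rewrite mulrC; apply: ideal_mul.
have [z zP z0] := Pn0; have [a [b [b0 zE]]] := locP z.
have aP : iota a \in P by rewrite -zE mulrC; apply: ideal_mul.
have a0 : a != 0.
  apply: contra_neq z0 => a0; apply: (mulIr (loc_embed_unit b0)).
  by rewrite zE a0 rmorph0 mul0r.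
have [g /PQ gQ gx] := prime_mod_x_neq0 Pprime xP a0 aP.
exact: y_in_prime gx.
Qed.

Lemma x_max : iota x \in loc_max origin.
Proof. by rewrite loc_max_embed originE hornerC hornerX. Qed.

Lemma y_max : iota y \in loc_max origin.
Proof. by rewrite loc_max_embed originE hornerX horner0. Qed.

Lemma x_in_x_ideal : iota x \in x_ideal.
Proof. by apply/asboolP; exists 1; rewrite mulr1. Qed.

Lemma y_notin_x_ideal : iota y \notin x_ideal.
Proof. by rewrite x_ideal_embed [mod_x y]mod_xy polyX_eq0. Qed.

Lemma iota_x_neq0 : iota x != 0.
Proof.
rewrite -(rmorph0 iota) (inj_eq (@loc_embed_inj _ _ origin)) polyC_eq0.
by rewrite polyX_eq0.
Qed.

Lemma local_krull_dim : krull_dim R 2.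
Proof.
split.
  pose C (i : nat) : {pred R} :=
    match i with 0 => pred1 0 | 1 => x_ideal | _ => loc_max origin end.
  exists C; split=> [[|[|[|//]]] _|[|[|//]] _] /=.
  - split=> [|u v]; last by rewrite !inE mulf_eq0.
    split; rewrite ?inE ?oner_eq0 // => r u v.
    by rewrite !inE => /eqP-> /eqP->; rewrite mulr0 addr0.
  - exact: x_ideal_prime.
  - exact: loc_max_prime.
  - split=> [z /eqP ->|/(_ _ x_in_x_ideal)].
      by apply/asboolP; exists 0; rewrite mulr0.
    by rewrite inE (negPf iota_x_neq0).
  - split=> [z /asboolP[w ->]|/(_ _ y_max)]; last exact/negP/y_notin_x_ideal.
    by rewrite mulrC; apply: (ideal_mul w (loc_max_ideal origin) x_max).
move=> l [C [Cprime Cstrict]]; rewrite leqNgt; apply/negP => l3.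
have [P0 P1 P2 P3] : [/\ prime_ideal (C 0), prime_ideal (C 1%N), prime_ideal (C 2%N)
    & prime_ideal (C 3%N)] by split; apply: Cprime; lia.
have [_ s01] : _ /\ _ := Cstrict 0 (ltn_trans (ltn_trans (ltnSn 0) (ltnSn 1)) l3).
have [c12 s12] := Cstrict 1 (ltn_trans (ltnSn 1) l3).
have [_ s23] := Cstrict 2 l3.
(* [C 1] lies strictly above [C 0], hence is nonzero, so [C 2] already contains the maximal ideal
   and leaves no room for [C 3]. *)
have mC2 : {subset loc_max origin <= C 2%N}.
  apply: second_prime_max c12 s12 _ => //; apply: contrapT => no.
  apply: s01 => z zC; have [->|z0] := eqVneq z 0; first by case: P0 => -[].
  by case: no; exists z.
by apply: s23 => z /(proper_sub_loc_max P3.1) /mC2.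
Qed.

Lemma max_min_generators : min_number_of_generators (loc_max origin) 2.
Proof.
have mid := loc_max_ideal origin; have [Xid Xp] := x_ideal_prime.
split.
  exists [:: iota x; iota y]; split=> //; apply: generates_span.
  - exact: idealr_closed_submod.
  - by move=> z; rewrite !inE => /orP[] /eqP ->; [exact: x_max | exact: y_max].
  move=> z zm; have [a [b [b0 zE]]] := locP z.
  move: zm; rewrite (loc_mem (idealr_closed_submod mid) b0 zE) loc_max_embed.
  have -> : z = (iota b)^-1 * iota a by rewrite -zE mulrC mulrK ?loc_embed_unit.
  move=> /eqP/origin0_gen[g [h ->]]; apply: ideal_spanZ; rewrite rmorphD !rmorphM.
  by apply: ideal_spanD; rewrite mulrC; apply/ideal_spanZ/mem_ideal_span;
    rewrite !inE eqxx ?orbT.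
move=> [|f [|//]] sm /=.
  have [c] := (sm _).1 x_max; rewrite big_ord0 => /eqP.
  by rewrite (negPf iota_x_neq0).
have [c] := (sm _).1 x_max; rewrite big_ord1 /= => xE.
have [d] := (sm _).1 y_max; rewrite big_ord1 /= => yE.
have fm : f \in loc_max origin.
  by apply/sm; exists (fun=> 1); rewrite big_ord1 mul1r.
(* A single generator [f] is outside the prime (x), so in x = c f the factor x must divide [c];
   cancelling it makes [f] a unit. *)
have fX : f \notin x_ideal.
  by apply: contraNN y_notin_x_ideal => fX; rewrite yE; apply: ideal_mul.
have := x_in_x_ideal; rewrite {1}xE => /Xp; rewrite (negPf fX) orbF.
move=> /asboolP[w cE]; move: fm; rewrite inE => /negP; case.
apply/unitrPr; exists w; apply: (mulfI iota_x_neq0).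
by rewrite mulr1 {2}xE cE; ring.
Qed.

Theorem local_ring_regular : regular_local_ring (loc_max origin) 2.
Proof.
split; [| exact: loc_unique_max | exact: local_krull_dim | exact: max_min_generators].
by apply/loc_noetherian/hilbert_basis/hilbert_basis/field_noetherian.
Qed.

End RegularLocalRing.

(** * Chains of submodules of a quotient *)

Section ChainsInQuotients.
Variables (R : nzRingType) (M : lmodType R).
Local Open Scope quotient_scope.

Lemma submod_add (J : {pred M}) x y : submod_closed J -> x \in J -> y \in J -> x + y \in J.
Proof. by move=> [_ JZ] xJ yJ; rewrite -[x]scale1r; apply: JZ. Qed.

Lemma submod_scale (J : {pred M}) a x : submod_closed J -> x \in J -> a *: x \in J.
Proof. by move=> [J0 JZ] xJ; rewrite -[_ *: _]addr0; apply: JZ. Qed.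

Lemma submod_sub (J : {pred M}) x y : submod_closed J -> x - y \in J -> y \in J -> x \in J.
Proof. by move=> Jmod xyJ yJ; rewrite -(subrK y x); apply: submod_add. Qed.

Lemma mem_submodE (S J : {pred M}) x y : submod_closed J -> {subset S <= J} ->
  submod_closed S -> x - y \in S -> (x \in J) = (y \in J).
Proof.
move=> Jmod SJ Smod xyS; apply/idP/idP; last exact: submod_sub Jmod (SJ _ xyS).
apply: (submod_sub Jmod); rewrite -opprB -scaleN1r; apply: submod_scale => //.
exact: SJ.
Qed.

(** This is the correspondence theorem: chains are pulled back along the projection, and pushed
    forward by testing representatives, whose choice is immaterial modulo [S]. *)
Lemma quot_strict_chain (S : {pred M}) (Smod : submod_closed S) l :
  has_strict_chain (fun T : {pred quot_module Smod} => submod_closed T) l <->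
  has_strict_chain (fun J : {pred M} => submod_closed J /\ {subset S <= J}) l.
Proof.
pose pi : M -> quot_module Smod := \pi_(quot_module Smod).
have piE x y : (pi x == pi y) = (x - y \in S) := quot_module_eqE Smod x y.
have piZD a u v : pi (a *: u + v) = a *: pi u + pi v.
  by rewrite /pi raddfD; congr (_ + _); exact: pi_quot_scale.
have piK : cancel repr pi := reprK.
have pi0 : pi 0 = 0 by rewrite /pi raddf0.
split=> -[C [Cmod Cstrict]].
  exists (fun i x => pi x \in C i); split=> [i /Cmod [C0 CZ]|i /Cstrict[sub nsub]].
    split; last first.
      move=> x xS; rewrite unfold_in; suff -> : pi x = 0 by [].
      by rewrite -pi0; apply/eqP; rewrite piE subr0.
    split=> [|a u v]; rewrite !unfold_in; first by rewrite pi0.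
    by rewrite piZD; apply: CZ.
  split=> [x|]; first exact: sub.
  by move=> nsub'; apply: nsub => x xC; have := nsub' (repr x); rewrite !unfold_in piK; apply.
have reprE i x : (i <= l)%N -> (repr (pi x : quot_module Smod) \in C i) = (x \in C i).
  by case/Cmod=> Jmod SJ; apply: (mem_submodE Jmod SJ Smod); rewrite -piE piK.
exists (fun i x => repr x \in C i); split=> [i il|i il].
  have [Jmod SJ] := Cmod i il.
  split=> [|a u v uC vC].
    by change (repr (0 : quot_module Smod) \in C i); rewrite -pi0 reprE //; case: Jmod.
  change (repr (a *: u + v) \in C i).
  have -> : a *: u + v = pi (a *: repr u + repr v) by rewrite piZD !piK.
  by rewrite reprE //; apply: submod_add => //; apply: submod_scale.
have [sub nsub] := Cstrict i il; split=> [x|nsub']; first exact: sub.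
apply: nsub => x; rewrite -(reprE i.+1) // -(reprE i) ?(ltnW il) //; exact: nsub'.
Qed.

(** Elements picked from the successive differences of a strict chain are independent over [k]
    modulo [S]. *)
Lemma strict_chain_bound (k : fieldType) (s : {rmorphism k -> R}) (S : {pred M}) N :
  (forall a : 'I_N.+1 -> M, exists u : 'I_N.+1 -> k,
     (exists i, u i != 0) /\ \sum_i s (u i) *: a i \in S) ->
  forall l, has_strict_chain (fun J : {pred M} => submod_closed J /\ {subset S <= J}) l ->
  (l <= N)%N.
Proof.
move=> dep l [C [Cmod Cstrict]]; rewrite leqNgt; apply/negP => Nl.
have ex i : exists z, (i < l)%N -> z \in C i.+1 /\ z \notin C i.
  have [il|] := boolP (i < l)%N; last by exists 0.
  have [_ nsub] := Cstrict i il; apply: contrapT => no; apply: nsub => z zC.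
  by apply: contrapT => /negP zC'; apply: no; exists z.
have [z zP] := choice ex.
have mono i j x : (i <= j <= l)%N -> x \in C i -> x \in C j.
  move=> /andP[]; elim: j => [|j IH]; first by rewrite leqn0 => /eqP ->.
  rewrite leq_eqVlt => /orP[/eqP -> //|ij jl xi].
  by apply: (Cstrict j jl).1; apply: IH => //; exact: ltnW.
have [u [[i0 ui0] uS]] := dep (fun i => z i).
(* For the last index with a nonzero coefficient all other terms lie in [C i], which forces [z i]
   into [C i]. *)
case: (@arg_maxnP _ i0 (fun i => u i != 0) val ui0) => i ui imax.
have il : (i < l)%N by apply: leq_trans (ltn_ord i) Nl.
have [Jmod SJ] := Cmod i (ltnW il); have [_ /negP] := zP i il; apply.
have -> : z i = s (u i)^-1 *: (s (u i) *: z i).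
  by rewrite scalerA -rmorphM mulVf // rmorph1 scale1r.
apply: submod_scale => //; move: uS => /SJ; rewrite (bigD1 i) //= => uS.
apply: (submod_sub Jmod (y := - \sum_(j < N.+1 | j != i) s (u j) *: z j)).
  by rewrite opprK.
rewrite -scaleN1r; apply: submod_scale => //.
apply: (big_ind (fun x => x \in C i)) => [|x y xC yC|j ji]; first by case: Jmod.
  exact: submod_add.
have [uj|/imax ji'] := eqVneq (u j) 0.
  by rewrite uj rmorph0 scale0r; case: Jmod.
have ji_lt : (j < i)%N by rewrite ltn_neqAle; apply/andP; split.
apply: submod_scale => //; apply: (mono j.+1); first by rewrite ji_lt ltnW.
by apply: (zP j _).1; apply: ltn_trans ji_lt il.
Qed.

End ChainsInQuotients.

Lemma max_chain_exists (T : Type) (P : {pred T} -> Prop) N :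
  (exists C, P C) -> (forall l, has_strict_chain P l -> (l <= N)%N) ->
  exists l, max_chain_length P l.
Proof.
move=> [C PC] bound.
have ex : exists l, `[< has_strict_chain P l >].
  by exists 0%N; apply/asboolP; exists (fun=> C).
have ub l : `[< has_strict_chain P l >] -> (l <= N)%N by move/asboolP/bound.
have [l /asboolP lchain lmax] := ex_maxnP ex ub; exists l; split=> // m mchain.
by apply/lmax/asboolP.
Qed.

(** * The valuation of an order function *)

Lemma int_le_sub (a b d s : nat) : (a + d <= s)%N ->
  a%:Z - b%:Z <= s%:Z - (b + d)%N%:Z.
Proof. lia. Qed.

Section OrderValuation.
Local Open Scope quotient_scope.

Lemma fraction_rep (R : idomainType) (x : {fraction R}) :
  exists r : R * R, r.2 != 0 /\ x * tofrac r.2 = tofrac r.1.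
Proof.
elim/quotW: x => r; exists (frac r); split; first exact: denom_ratioP.
unlock tofrac; rewrite -[LHS]FracField.pi_mul; apply/eqmodP.
rewrite /= FracField.equivfE /FracField.mulf !numden_Ratio ?oner_neq0 ?mulr1 ?denom_ratioP //.
by rewrite mulrC.
Qed.

Variables (R : idomainType) (v : R -> nat).
Hypothesis vM : forall a b, a != 0 -> b != 0 -> v (a * b) = (v a + v b)%N.
Hypothesis vD : forall a b, a != 0 -> b != 0 -> a + b != 0 ->
  (minn (v a) (v b) <= v (a + b))%N.
Variable p : R.
Hypotheses (p_neq0 : p != 0) (vp : v p = 1%N).
Implicit Types x y : {fraction R}.

Definition frac_rep x : R * R := projT1 (cid (fraction_rep x)).

Lemma frac_repP x : (frac_rep x).2 != 0 /\ x * tofrac (frac_rep x).2 = tofrac (frac_rep x).1.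
Proof. by rewrite /frac_rep; case: cid. Qed.

Definition frac_val x : \bar int :=
  if x == 0 then +oo%E else ((v (frac_rep x).1)%:Z - (v (frac_rep x).2)%:Z)%:E.

(** Two representations have equal cross products, so the value does not depend on the one chosen by
    [frac_rep]. *)
Lemma frac_valE x a b : a != 0 -> b != 0 -> x * tofrac b = tofrac a ->
  frac_val x = ((v a)%:Z - (v b)%:Z)%:E.
Proof.
move=> a0 b0 xE; have x0 : x != 0.
  by apply: contra_neq a0 => x0; move: xE; rewrite x0 mul0r => /esym/eqP;
    rewrite tofrac_eq0 => /eqP.
rewrite /frac_val (negPf x0); have [] := frac_repP x.
case: (frac_rep x) => n d /= d0 xE'.
have n0 : n != 0 by rewrite -tofrac_eq0 -xE' mulf_neq0 ?tofrac_eq0.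
have : n * b = a * d by apply/eqP; rewrite -tofrac_eq !tofracM -xE -xE' mulrAC.
move/(congr1 v); rewrite !vM // => vE; congr (_%:E); lia.
Qed.

Lemma fracP x : x != 0 -> exists a b, [/\ a != 0, b != 0 & x * tofrac b = tofrac a].
Proof.
move=> x0; have [[n d] /= [d0 xE]] := fraction_rep x; exists n, d; split=> //.
by rewrite -tofrac_eq0 -xE mulf_neq0 ?tofrac_eq0.
Qed.

Lemma frac_val0 : frac_val 0 = +oo%E.
Proof. by rewrite /frac_val eqxx. Qed.

Lemma frac_val_fin x : x != 0 -> frac_val x \is a fin_num.
Proof. by move=> /negPf x0; rewrite /frac_val x0. Qed.

Lemma frac_valM x y : frac_val (x * y) = (frac_val x + frac_val y)%E.
Proof.
have [->|x0] := eqVneq x 0.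
  rewrite mul0r frac_val0; have [->|/frac_val_fin] := eqVneq y 0; first by rewrite frac_val0.
  by case: (frac_val y).
have [->|y0] := eqVneq y 0.
  by rewrite mulr0 frac_val0; have := frac_val_fin x0; case: (frac_val x).
have [a [b [a0 b0 xE]]] := fracP x0; have [c [d [c0 d0 yE]]] := fracP y0.
rewrite (frac_valE a0 b0 xE) (frac_valE c0 d0 yE).
rewrite (@frac_valE _ (a * c) (b * d)) ?mulf_neq0 //.
  by rewrite !vM // -EFinD; congr (_%:E); lia.
by rewrite !tofracM -xE -yE mulrACA.
Qed.

Lemma frac_valD x y : (Order.min (frac_val x) (frac_val y) <= frac_val (x + y)%R)%E.
Proof.
have [->|x0] := eqVneq x 0; first by rewrite add0r ge_min lexx orbT.
have [->|y0] := eqVneq y 0; first by rewrite addr0 ge_min lexx.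
have [->|xy0] := eqVneq (x + y) 0; first by rewrite frac_val0 leey.
have [a [b [a0 b0 xE]]] := fracP x0; have [c [d [c0 d0 yE]]] := fracP y0.
have sE : (x + y) * tofrac (b * d) = tofrac (a * d + c * b).
  by rewrite tofracD !tofracM -xE -yE; ring.
have s0 : a * d + c * b != 0.
  by rewrite -tofrac_eq0 -sE mulf_neq0 // tofrac_eq0 mulf_neq0.
rewrite (frac_valE a0 b0 xE) (frac_valE c0 d0 yE) (frac_valE s0 _ sE) ?mulf_neq0 //.
have := vD (mulf_neq0 a0 d0) (mulf_neq0 c0 b0) s0; rewrite !vM // geq_min ge_min !lee_fin.
by case/orP => h; apply/orP; [left | right; rewrite addnC]; apply: int_le_sub.
Qed.

Lemma v_exp n : v (p ^+ n) = n.
Proof.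
elim: n => [|n IH]; last by rewrite exprS vM ?expf_neq0 // vp IH.
by have := vM (oner_neq0 R) (oner_neq0 R); rewrite mulr1 expr0; case: (v 1) => // n; lia.
Qed.

Lemma frac_val_onto (k : int) : exists x, frac_val x = k%:E.
Proof.
have pn n : p ^+ n != 0 by rewrite expf_neq0.
case: (intP k) => [|n|n].
- exists (tofrac 1); rewrite (@frac_valE _ 1 1) ?oner_neq0 ?mulr1 ?subrr //.
- exists (tofrac (p ^+ n.+1)); rewrite (@frac_valE _ (p ^+ n.+1) (p ^+ 0)) //.
    by rewrite !v_exp subr0.
  by rewrite tofrac1 mulr1.
- exists (tofrac (p ^+ n.+1))^-1; rewrite (@frac_valE _ (p ^+ 0) (p ^+ n.+1)) //.
    by rewrite !v_exp sub0r.
  by rewrite mulVf ?tofrac_eq0 // tofrac1.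
Qed.

Definition order_valuation : discrete_valuation {fraction R} :=
  DiscreteValuation frac_val0 frac_val_fin frac_valM frac_valD frac_val_onto.

Lemma order_valuationE a : a != 0 -> order_valuation (tofrac a) = (v a)%:Z%:E.
Proof.
move=> a0; rewrite /= (@frac_valE _ a (p ^+ 0)) ?expf_neq0 ?v_exp ?subr0 //.
by rewrite tofrac1 mulr1.
Qed.

End OrderValuation.

(** * The curve y (t) *)

Section Curve.
Variable F : realType.
Local Notation A := {poly {poly rat}}.
Implicit Types (h : {poly F}) (f : A).

Definition lift_coef : {rmorphism {poly rat} -> {poly F}} := map_poly ratr.
Definition ev h : {rmorphism A -> {poly F}} := horner_eval h \o map_poly lift_coef.

Lemma evE h f : ev h f = (map_poly lift_coef f).[h]. Proof. by []. Qed.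

Lemma evC h c : ev h c%:P = lift_coef c.
Proof. by rewrite evE map_polyC hornerC. Qed.

Lemma evX h : ev h 'X = h.
Proof. by rewrite evE map_polyX hornerX. Qed.

Lemma ev_tower j h f s : (forall i, tower j h`_i) -> tower j (ev h f)`_s.
Proof.
move=> hL; elim/poly_ind: f s => [|f c IH] s.
  by rewrite rmorph0 coef0; apply: tower0.
rewrite rmorphD rmorphM evX evC coefD coefM coef_map.
by apply: towerD; [apply: tower_sum => i _; apply: towerM | apply: tower_rat].
Qed.

(** The constant depends on [f] alone, so the exponents, which grow faster than any fixed multiple
    of the size of the truncation, eventually exceed the bound. *)
Lemma size_ev f : exists C, forall h, (size (ev h f) <= C + C * size h)%N.
Proof.
elim/poly_ind: f => [|f c [C IH]]; first by exists 0%N => h; rewrite rmorph0 size_poly0.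
exists (C + size (lift_coef c) + 1)%N => h; rewrite rmorphD rmorphM evX evC.
apply: leq_trans (size_polyD _ _) _; rewrite geq_max; apply/andP; split; last by lia.
by apply: leq_trans (size_polyMleq _ _) _; have := IH h; lia.
Qed.

Lemma horner_add_dvd (q : {poly {poly F}}) h b : exists g, q.[h + b] = q.[h] + b * g.
Proof.
have : root (q - q.[h]%:P) h by rewrite rootE hornerD hornerN hornerC subrr.
case/factor_theorem => g qE; exists g.[h + b].
have := congr1 (fun p : {poly {poly F}} => p.[h + b]) qE.
rewrite hornerD hornerN hornerC hornerM hornerXsubC => /eqP; rewrite subr_eq => /eqP ->.
by ring.
Qed.

(** An annihilator of least degree in y works: in characteristic 0 its derivative is a nonzero
    polynomial of smaller degree, hence does not annihilate [h]. *)
Lemma separable_annihilator h : integralOver lift_coef h ->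
  exists P : A, ev h P = 0 /\ ev h P^`() != 0.
Proof.
move=> [p p_monic ph0].
have ex : exists n, `[< exists P : A, [/\ P != 0, ev h P = 0 & size P = n] >].
  exists (size p); apply/asboolP; exists p; split=> //; first exact: monic_neq0.
  by apply/eqP.
have [_ /asboolP[P [P0 hP <-]] Pmin] := ex_minnP ex; exists P; split=> //.
apply/negP => /eqP P'0.
have P'n0 : P^`() != 0.
  apply: contra_neq (P0) => dP.
  have sP : (size P <= 1)%N.
    rewrite leqNgt; apply/negP => sP.
    have := congr1 (fun q : A => q`_(size P).-2) dP.
    have s1 : (0 < (size P).-1)%N by lia.
    rewrite coef0 coef_deriv prednK // -(scaler_nat (size P).-1 _ : _%:R *: (_ : {poly rat}) = _).
    rewrite -lead_coefE -mul_polyC => /eqP; rewrite mulf_eq0 polyC_eq0 pnatr_eq0.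
    by rewrite lead_coef_eq0 (negPf P0) orbF eqn0Ngt s1.
  have [c PE] : exists c, P = c%:P by exists P`_0; apply: size1_polyC.
  move: hP; rewrite PE evC => /eqP; rewrite map_poly_eq0 => /eqP ->.
  by rewrite polyC0.
have /Pmin : `[< exists Q : A, [/\ Q != 0, ev h Q = 0 & size Q = size P^`()] >].
  by apply/asboolP; exists P^`().
by rewrite leqNgt lt_size_deriv.
Qed.

(** Taylor expansion at the root [h]: the cofactor of y - h takes the value P'(h) there. *)
Lemma ev_simple_root h P : ev h P = 0 ->
  forall b, exists g, ev (h + b) P = b * (ev h P^`() + b * g).
Proof.
rewrite !evE -deriv_map => /eqP /factor_theorem[q qE] b.
have [g qb] := horner_add_dvd q h b; exists g.
rewrite evE qE derivM derivXsubC mulr1 hornerD !hornerM !hornerXsubC qb.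
by ring.
Qed.

Lemma integral_root2 j : integralOver lift_coef (root2 F j)%:P.
Proof.
exists ('X^(2 ^ j) - (2%:P)%:P); first by rewrite monicXnsubC // expn_gt0.
rewrite rootE rmorphB /= map_polyXn map_polyC /= hornerD hornerN hornerXn hornerC.
by rewrite -rmorphXn root2_exp map_polyC /= (rmorph_nat (@ratr F)) subrr.
Qed.

Lemma integral_scale_Xn j e : integralOver lift_coef (root2 F j *: 'X^e).
Proof.
rewrite -mul_polyC; apply: integral_mul; first exact: integral_root2.
have <- : lift_coef 'X^e = 'X^e by rewrite /= map_polyXn.
exact: integral_id.
Qed.

(** The recursion for the exponents needs the bound as a function of the truncation; choice gives it
    on all polynomials, without constraint where [h] is not integral. *)
Lemma separation_exists : exists sep : {poly F} -> nat,
  forall h, integralOver lift_coef h ->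
    exists P : A, [/\ ev h P = 0, ev h P^`() != 0 & (size (ev h P^`()) <= sep h)%N].
Proof.
have ex h : exists n, integralOver lift_coef h ->
    exists P : A, [/\ ev h P = 0, ev h P^`() != 0 & (size (ev h P^`()) <= n)%N].
  have [hint|nint] := pselect (integralOver lift_coef h); last by exists 0%N.
  have [P [hP hP']] := separable_annihilator hint.
  by exists (size (ev h P^`())) => _; exists P; split.
have [sep sepP] := choice ex; exists sep; exact: sepP.
Qed.

Definition separation : {poly F} -> nat := projT1 (cid separation_exists).

Lemma separationP h : integralOver lift_coef h ->
  exists P : A, [/\ ev h P = 0, ev h P^`() != 0 & (size (ev h P^`()) <= separation h)%N].
Proof. by rewrite /separation; case: cid => sep sepP; apply: sepP. Qed.

(* The factorial provides the divisors; the four summands serve, in turn, the transcendence of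
   the curve, the leading coefficients in [new_lead_coef], the bound 2^j n = o (n^2) on the
   length, and [j < next_exponent j h], by which truncation s determines the coefficient of t^s. *)
Definition next_exponent j h := (j`! * (size h * j.+1 + separation h + j * 2 ^ j + j.+1))%N.

Fixpoint truncation j : {poly F} :=
  if j is i.+1 then truncation i + root2 F i.+1 *: 'X^(next_exponent i (truncation i)) else 0.

(** This is e_(j+1), the exponent of the first term missing from [truncation j]. *)
Definition gap_exponent j := next_exponent j (truncation j).

Local Notation Y := truncation.

Lemma truncationS j : Y j.+1 = Y j + root2 F j.+1 *: 'X^(gap_exponent j).
Proof. by []. Qed.

Lemma gap_exponent_dvd j p : (0 < p <= j)%N -> (p %| gap_exponent j)%N.
Proof. by move=> pj; apply/dvdn_mulr/dvdn_fact. Qed.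

Lemma gap_exponent_ge j :
  (size (Y j) * j.+1 + separation (Y j) + j * 2 ^ j + j.+1 <= gap_exponent j)%N.
Proof. by rewrite /gap_exponent /next_exponent leq_pmull // fact_gt0. Qed.

Lemma size_truncation_le j : (size (Y j) <= gap_exponent j)%N.
Proof. by apply: leq_trans (gap_exponent_ge j); rewrite mulnS -!addnA leq_addr. Qed.

Lemma gap_exponent_gt j : (j < gap_exponent j)%N.
Proof. by apply: leq_trans (gap_exponent_ge j); rewrite leq_addl. Qed.

Lemma size_truncationS j : size (Y j.+1) = (gap_exponent j).+1.
Proof.
have sX : size (root2 F j.+1 *: 'X^(gap_exponent j)) = (gap_exponent j).+1.
  by rewrite size_scale ?size_polyXn // gt_eqF // root2_gt0.
by rewrite truncationS addrC size_polyDl sX // ltnS size_truncation_le.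
Qed.

Lemma gap_exponent_incr j : (gap_exponent j < gap_exponent j.+1)%N.
Proof. by rewrite -size_truncationS; apply: size_truncation_le. Qed.

Lemma gap_exponent_le i j : (i <= j)%N -> (gap_exponent i <= gap_exponent j)%N.
Proof. by apply: (homo_leq leqnn leq_trans) => n; apply/ltnW/gap_exponent_incr. Qed.

Lemma truncation_tower j s : tower j (Y j)`_s.
Proof.
elim: j s => [|j IH] s; first by rewrite coef0; apply: tower0.
rewrite truncationS coefD coefZ coefXn; apply: towerD; first by apply/towerS/IH.
by case: eqP => _; rewrite ?mulr1 ?mulr0; [apply: root2_tower | apply: tower0].
Qed.

Lemma truncation_integral j : integralOver lift_coef (Y j).
Proof.
elim: j => [|j IH]; first by exists 'X; rewrite ?monicX // map_polyX rootX.
by rewrite truncationS; apply: integral_add => //; apply: integral_scale_Xn.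
Qed.

Lemma truncation_next i j : (i < j)%N ->
  exists h, h`_0 = root2 F i.+1 /\ Y j = Y i + 'X^(gap_exponent i) * h.
Proof.
elim: j => // j IH; rewrite ltnS leq_eqVlt => /orP[/eqP ->|ij].
  by exists (root2 F j.+1)%:P; rewrite coefC truncationS mulrC mul_polyC.
have [h [h0 YE]] := IH ij.
exists (h + root2 F j.+1 *: 'X^(gap_exponent j - gap_exponent i)); split.
  rewrite coefD h0 coefZ coefXn; case: eqP => [|_]; last by rewrite mulr0 addr0.
  have : (gap_exponent i < gap_exponent j)%N
    by apply: leq_trans (gap_exponent_incr i) (gap_exponent_le ij).
  by rewrite -subn_gt0 lt0n => /eqP d /esym.
rewrite truncationS YE mulrDr addrA; congr (_ + _).
by rewrite -scalerAr -exprD subnKC // gap_exponent_le // ltnW.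
Qed.

(** The two truncations differ by a multiple of t^(gap_exponent i), hence so do the values of [f] at
    them. *)
Lemma truncation_stable i j f s : (i <= j)%N -> (s < gap_exponent i)%N ->
  (ev (Y j) f)`_s = (ev (Y i) f)`_s.
Proof.
rewrite leq_eqVlt => /orP[/eqP -> //|ij] se; have [h [_ ->]] := truncation_next ij.
rewrite evE; have [g ->] := horner_add_dvd (map_poly lift_coef f) (Y i) ('X^(gap_exponent i) * h).
by rewrite coefD -mulrA coefXnM se addr0.
Qed.

(* The s-th coefficient of f(t, y(t)), where y is the t-adic limit of the truncations. *)
Definition curve_coef f s : F := (ev (Y s) f)`_s.

Lemma curve_coefE i f s : (s < gap_exponent i)%N -> curve_coef f s = (ev (Y i) f)`_s.
Proof.
move=> si; rewrite /curve_coef.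
have [is_|si_] := leqP i s; first by apply: truncation_stable.
by apply/esym/truncation_stable; [exact: ltnW | exact: gap_exponent_gt].
Qed.

Lemma curve_coefD f g s : curve_coef (f + g) s = curve_coef f s + curve_coef g s.
Proof. by rewrite /curve_coef rmorphD coefD. Qed.

Lemma curve_coefM f g s :
  curve_coef (f * g) s = \sum_(i < s.+1) curve_coef f i * curve_coef g (s - i).
Proof.
rewrite /curve_coef rmorphM coefM; apply: eq_bigr => i _.
have si : (i <= s)%N by rewrite -ltnS.
by rewrite -(@curve_coefE s f i) ?(leq_ltn_trans si) ?gap_exponent_gt // -(@curve_coefE s g)
  // (leq_ltn_trans (leq_subr _ _)) // gap_exponent_gt.
Qed.

Lemma curve_coef_const q f s : curve_coef (q%:P%:P * f) s = ratr q * curve_coef f s.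
Proof. by rewrite /curve_coef rmorphM evC /= map_polyC coefCM. Qed.

Lemma curve_coef_sum (I : finType) (f : I -> A) s :
  curve_coef (\sum_i f i) s = \sum_i curve_coef (f i) s.
Proof. by rewrite /curve_coef rmorph_sum coef_sum. Qed.

Lemma curve_coef_at0 f : curve_coef f 0 = ratr f.[0].[0].
Proof.
rewrite [RHS]/= !horner_coef0; have -> : curve_coef f 0 = ((map_poly lift_coef f).[0])`_0 by [].
by rewrite horner_coef0 coef_map coef_map.
Qed.

Lemma curve_coef_tower j f s : (s < gap_exponent j)%N -> tower j (curve_coef f s).
Proof. by move=> sj; rewrite (curve_coefE f sj); apply/ev_tower/truncation_tower. Qed.

(** * Order of vanishing along the curve *)

Definition vanishes_below n f := forall s, (s < n)%N -> curve_coef f s = 0.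

Lemma vanishes_belowD n f g : vanishes_below n f -> vanishes_below n g -> vanishes_below n (f + g).
Proof. by move=> fn gn s sn; rewrite curve_coefD fn ?gn ?addr0. Qed.

Lemma vanishes_below_le m n f : (m <= n)%N -> vanishes_below n f -> vanishes_below m f.
Proof. by move=> mn fn s sm; apply/fn/(leq_trans sm). Qed.

Lemma curve_coef_lead m n f g : vanishes_below m f -> vanishes_below n g ->
  curve_coef (f * g) (m + n) = curve_coef f m * curve_coef g n.
Proof.
move=> fm gn; rewrite curve_coefM (bigD1 (inord m)) //= inordK ?ltnS ?leq_addr // addKn.
rewrite big1 ?addr0 // => i; rewrite -val_eqE /= inordK ?ltnS ?leq_addr // => im.
have [lt_im|gt_im|eq_im] := ltngtP i m; last by rewrite eq_im eqxx in im.
  by rewrite fm ?mul0r.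
by rewrite gn ?mulr0 //; have := ltn_ord i; lia.
Qed.

Lemma vanishes_belowM m n f g : vanishes_below m f -> vanishes_below n g ->
  vanishes_below (m + n) (f * g).
Proof.
move=> fm gn s smn; rewrite curve_coefM big1 // => i _.
have [lt_im|ge_im] := ltnP i m; first by rewrite fm ?mul0r.
by rewrite gn ?mulr0 //; have := ltn_ord i; lia.
Qed.

(** The truncations are distinct, so [f] is nonzero at one with arbitrarily large index. The value
    there has degree below the next exponent, so its coefficients are already those on the curve. *)
Lemma curve_coef_neq0 f : f != 0 -> exists s, curve_coef f s != 0.
Proof.
move=> f0; have [C sizeC] := size_ev f.
pose p := map_poly lift_coef f.
have p0 : p != 0.
  by rewrite map_poly_eq0_id0 ?map_poly_eq0 ?lead_coef_eq0.
have [i Ci Yi] : exists2 i, (C <= i)%N & ev (Y i) f != 0.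
  apply: contrapT => no.
  have Yroot i : (C <= i)%N -> root p (Y i).
    by move=> Ci; apply: contrapT => /negP Yi; apply: no; exists i.
  have Yinj : injective Y.
    move=> a b; wlog ab : a b / (a < b)%N.
      by move=> W; case: (ltngtP a b) => // ab; [apply: W | move/esym/W => ->].
    move=> /(congr1 (fun h : {poly F} => size h)); case: b ab => // b ab.
    rewrite size_truncationS => sa; have := size_truncation_le a.
    by rewrite sa ltnNge gap_exponent_le.
  have : (size [seq Y i | i <- iota C (size p)] < size p)%N.
    apply: max_poly_roots => //; last by rewrite map_inj_uniq ?iota_uniq.
    by apply/allP => _ /mapP[i] /[!mem_iota] /andP[Ci _] ->; apply: Yroot.
  by rewrite size_map size_iota ltnn.
have [s si] : exists2 s, (s < size (ev (Y i) f))%N & (ev (Y i) f)`_s != 0.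
  exists (size (ev (Y i) f)).-1; first by rewrite ltn_predL size_poly_gt0.
  by rewrite -lead_coefE lead_coef_eq0.
exists s; rewrite (@curve_coefE i) // ; apply: leq_trans si _; apply: leq_trans (sizeC _) _.
apply: leq_trans (gap_exponent_ge i); nia.
Qed.

(* The annihilator P of the truncation y_j has P (y) = (y - y_j) (P' (y_j) + O (y - y_j)), whose
   leading coefficient is that of y - y_j, namely root2 j.+1, times an element of L_j. *)
Lemma new_lead_coef j : exists f o,
  [/\ (0 < o)%N, vanishes_below o f, tower j.+1 (curve_coef f o) & ~ tower j (curve_coef f o)].
Proof.
have [P [YP YP' sP]] := separationP (truncation_integral j).
set d := ev (Y j) P^`() in YP' sP.
have exd : exists s, d`_s != 0.
  by exists (size d).-1; rewrite -lead_coefE lead_coef_eq0.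
have [s ds smin] := ex_minnP exd.
have d_lt u : (u < s)%N -> d`_u = 0.
  by move=> us; apply/eqP; apply: contraTT us => /smin; rewrite -leqNgt.
(* The bound [separation] enters here: the order [s] of P'(y_j) stays below the next exponent. *)
have s_lt : (s < gap_exponent j)%N.
  apply: leq_trans (gap_exponent_ge j); have : (s < size d)%N.
    by rewrite ltnNge; apply: contraNN ds => /leq_sizeP ->.
  lia.
exists P, (gap_exponent j + s)%N.
have [i ij si] : exists2 i, (j < i)%N & (gap_exponent j + s < gap_exponent i)%N.
  exists (gap_exponent j + s).+1; first by have := gap_exponent_gt j; lia.
  by apply: leq_trans (gap_exponent_gt _).
have [h [h0 YE]] := truncation_next ij.
have [g PE] := ev_simple_root YP ('X^(gap_exponent j) * h).
(* The quadratic remainder carries t to twice the gap exponent, beyond the degrees considered as [s]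
   is below that exponent. *)
have coP u : (u <= s)%N -> curve_coef P (gap_exponent j + u) = (h * d)`_u.
  move=> us; rewrite (curve_coefE (i := i)) ?(leq_ltn_trans _ si) ?leq_add2l // YE PE -mulrA.
  rewrite coefXnM ltnNge leq_addr /= addKn mulrDr coefD.
  have -> : h * ('X^(gap_exponent j) * h * g) = 'X^(gap_exponent j) * (h * (h * g)).
    by rewrite -mulrA mulrCA.
  by rewrite coefXnM (leq_ltn_trans us s_lt) addr0.
have hd u : (u <= s)%N -> (h * d)`_u = h`_0 * d`_u.
  move=> us; rewrite coefM big_ord_recl subn0 big1 ?addr0 // => v _.
  by rewrite d_lt ?mulr0 // lift0; have := ltn_ord v; lia.
have dL : tower j d`_s by apply/ev_tower/truncation_tower.
have aE : curve_coef P (gap_exponent j + s) = root2 F j.+1 * d`_s by rewrite coP // hd // h0.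
split.
- by rewrite addn_gt0 (leq_ltn_trans _ (gap_exponent_gt j)).
- move=> u ue; have [uj|ju] := ltnP u (gap_exponent j).
    rewrite (curve_coefE (i := i)) ?(ltn_trans uj) ?expo_lt //; last by lia.
    by rewrite YE PE -mulrA coefXnM uj.
  by rewrite -(subnKC ju) coP ?hd ?d_lt ?mulr0 //; lia.
- by rewrite aE; apply: towerM; [apply: root2_tower | apply: towerS].
- rewrite aE => aL; apply: (@root2_notin_tower F j).
  by rewrite -(mulfK ds (root2 F j.+1)); apply: towerM => //; apply: towerV.
Qed.

End Curve.

(** * Growth of quasi-polynomials *)

Section QuasiPolynomialGrowth.
Variable F : realType.
Import numFieldNormedType.Exports.

Lemma periodic_mulrn (a : int -> F) (p : int) (m : nat) : periodic a p -> a (p * m%:Z) = a 0.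
Proof.
by move=> ap; rewrite -[RHS](periodicn ap m) add0r -mulr_natr natz.
Qed.

Lemma quasi_polynomial_on_multiples (Q : int -> F) : quasi_polynomial Q ->
  exists (p : nat) (q : {poly F}), (0 < p)%N /\
    forall n : nat, (p %| n)%N -> Q n = q.[n%:R].
Proof.
move=> [d [a [per QE]]].
have {}per i : exists p : int, 0 < p /\ periodic (a i) p by have [p] := per i; exists p.
have [P PP] := choice per.
(* The product of the periods is a common period, and on its multiples each coefficient takes its
   value at 0. *)
exists (\prod_i `|P i|)%N, (\poly_(i < d.+1) a (inord i) 0); split.
  by rewrite prodn_gt0 // => i; rewrite absz_gt0 gt_eqF //; case: (PP i).
move=> n pn; rewrite QE horner_poly; apply: eq_bigr => i _.
rewrite inord_val -pmulrn; congr (_ * _).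
have [Pi_gt0 per_i] := PP i.
have /dvdnP[m ->] : (`|P i| %| n)%N.
  by apply: dvdn_trans pn; rewrite (bigD1 i) //= dvdn_mulr.
by rewrite PoszM gez0_abs ?ltW // mulrC (periodic_mulrn m per_i).
Qed.

Lemma poly_size_gt2_quadratic (q : {poly F}) : (2 < size q)%N ->
  exists2 c : F, 0 < c & exists N : nat, forall n : nat, (N <= n)%N ->
    c * n%:R ^+ 2 <= `|q.[n%:R]|.
Proof.
move=> q2; pose d := (size q).-1; pose l := `|lead_coef q|.
have sq : size q = d.+1 by rewrite prednK // (ltn_trans _ q2).
have l_gt0 : 0 < l by rewrite normr_gt0 lead_coef_eq0 -size_poly_gt0 sq.
pose B := \sum_(i < d) `|q`_i|.
have B0 : 0 <= B by apply: sumr_ge0 => i _.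
(* Once n >= 2 B / l, the lower terms, at most B n^(d-1), are absorbed by half of the leading
   term. *)
exists (l / 2); first by rewrite divr_gt0.
have [N NB] : exists N : nat, 2 * B / l <= N%:R.
  by exists (Num.bound (2 * B / l)); apply/ltW/archi_boundP; rewrite divr_ge0 ?mulr_ge0 // ltW.
exists (maxn 1 N) => n; rewrite geq_max => /andP[n1 Nn].
have n1F : 1 <= n%:R :> F by rewrite (ler_nat F 1).
have n0F : 0 <= n%:R :> F by rewrite ler0n.
have nB : B <= l / 2 * n%:R.
  have : 2 * B / l <= n%:R by apply: le_trans NB _; rewrite ler_nat.
  rewrite ler_pdivrMr // => H; lra.
have d2 : (1 < d)%N by rewrite -ltnS -sq.
have lowE : `|\sum_(i < d) q`_i * n%:R ^+ i| <= B * n%:R ^+ d.-1.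
  apply: le_trans (ler_norm_sum _ _ _) _; rewrite /B mulr_suml; apply: ler_sum => i _.
  rewrite normrM ler_wpM2l // normrX ger0_norm // ler_weXn2l //.
  by have := ltn_ord i; lia.
have -> : q.[n%:R] = \sum_(i < d) q`_i * n%:R ^+ i + lead_coef q * n%:R ^+ d.
  by rewrite horner_coef sq big_ord_recr lead_coefE sq.
have dE : n%:R ^+ d = n%:R ^+ d.-1 * n%:R :> F by rewrite -exprSr prednK // ltnW.
have pd : n%:R <= n%:R ^+ d.-1 :> F by rewrite -[leLHS]expr1 ler_weXn2l //; lia.
have tri : l * n%:R ^+ d - B * n%:R ^+ d.-1 <=
    `|\sum_(i < d) q`_i * n%:R ^+ i + lead_coef q * n%:R ^+ d|.
  rewrite [X in `|X|]addrC; apply: le_trans (lerB_normD _ _).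
  by rewrite lerB // normrM [`|n%:R ^+ d|]ger0_norm ?exprn_ge0.
apply: le_trans tri; rewrite dE.
have -> : l * (n%:R ^+ d.-1 * n%:R) - B * n%:R ^+ d.-1 = n%:R ^+ d.-1 * (l * n%:R - B) by ring.
apply: (@le_trans _ _ (n%:R * (l / 2 * n%:R))); first by rewrite expr2 mulrCA.
apply: ler_pM => //; first by rewrite mulr_ge0 // divr_ge0 // ltW.
lra.
Qed.

(* On the multiples of a period the quasi-polynomial is one polynomial q; q = o(n^2) along the
   n j forces deg q <= 1, against superlinear growth. *)
Lemma not_quasi_polynomial (f : nat -> nat) (n : nat -> nat) :
  (forall j, (n j < n j.+1)%N) ->
  (forall j p, (0 < p <= j)%N -> (p %| n j)%N) ->
  (forall j, (j * f (n j) <= n j ^ 2)%N) ->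
  (forall C, exists N, forall m, (C * m <= f m + C * N)%N) ->
  ~ eventually_quasi_polynomial_plus_bounded (fun m => (f m)%:R : F).
Proof.
move=> n_incr n_div f_small f_large [Q [sigma [n0 [Qqp bsigma fE]]]].
have [p [q [p0 Qq]]] := quasi_polynomial_on_multiples Qqp.
have [M M0 sM] : exists2 M : F, 0 <= M & forall m, `|sigma m| <= M.
  have /ex_strict_bound_gt0[M M0 sM] := bsigma; exists M; first exact: ltW.
  by move=> m; apply/ltW/sM.
have n_ge j : (j <= n j)%N.
  by elim: j => // j IH; apply: leq_ltn_trans IH (n_incr j).
have qE j : (p <= j)%N -> (n0 <= j)%N -> (f (n j))%:R = q.[(n j)%:R] + sigma (n j).
  move=> pj n0j; rewrite fE ?Qq ?n_div ?p0 //.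
  exact: leq_trans n0j (n_ge j).
have [q2|q2] := leqP (size q) 2.
  pose a := `|q`_0| + `|q`_1| + M.
  have a0 : 0 <= a by rewrite !addr_ge0.
  have qn m : (0 < m)%N -> `|q.[m%:R]| <= (`|q`_0| + `|q`_1|) * m%:R.
    move=> m0; have m1 : 1 <= m%:R :> F by rewrite (ler_nat F 1).
    have -> : q.[m%:R] = q`_0 + q`_1 * m%:R.
      rewrite (horner_coef_wide _ q2) big_ord_recr big_ord1 /=.
      by rewrite expr0 mulr1 expr1.
    apply: le_trans (ler_normD _ _) _; rewrite mulrDl normrM.
    rewrite [`|m%:R|]ger0_norm ?ler0n // lerD2r ler_peMr //.
  (* The slope exceeds [a] by at least 1, whereas f (n j) <= a (n j); this is impossible once n j
     exceeds K N. *)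
  have [N NP] := f_large (Num.bound a).+1.
  set K := (Num.bound a).+1 in NP; pose j := (maxn p n0 + K * N).+1.
  have jn := n_ge j; have x_gt0 : (0 < n j)%N by apply: leq_trans jn.
  have := NP (n j); rewrite -(ler_nat F) natrD !natrM qE; [|lia|lia].
  have KN_lt : (K * N).+1%:R <= (n j)%:R :> F.
    by rewrite ler_nat; apply: leq_trans jn; rewrite ltnS leq_addl.
  have Ka : a + 1 <= K%:R by rewrite /K -natr1 lerD2r ltW // archi_boundP.
  have x1 : 1 <= (n j)%:R :> F by rewrite (ler_nat F 1).
  move: (qn _ x_gt0) (sM (n j)) KN_lt; rewrite -natr1 natrM /a in Ka *.
  move: Ka x1; move: (n j)%:R q.[_] (sigma _) => x u v Ka x1.
  rewrite !ler_norml => /andP[_ uB] /andP[_ vB] KNx Kx.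
  have KaX : 0 <= (K%:R - (`|q`_0| + `|q`_1| + M) - 1) * x by rewrite mulr_ge0; lra.
  have MX : 0 <= M * (x - 1) by rewrite mulr_ge0 // subr_ge0.
  lra.
have [c c0 [N cN]] := poly_size_gt2_quadratic q2.
(* With j >= 2 / c one has f (n j) <= c (n j)^2 / 2, whence c (n j)^2 <= 2 M, contrary to n j > 2 M
   / c. *)
pose j := (maxn (maxn p n0) N + Num.bound (2 / c) + Num.bound (2 * M / c)).+1.
have jn := n_ge j.
have x1 : 1 <= (n j)%:R :> F by rewrite (ler_nat F 1); apply: leq_trans jn.
have bound1 : 2 / c <= j%:R.
  apply: ltW; apply: lt_le_trans (archi_boundP _) _; rewrite ?divr_ge0 ?(ltW c0) //.
  by rewrite ler_nat /j; lia.
have bound2 : 2 * M / c + 1 <= (n j)%:R.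
  apply: (@le_trans _ _ ((Num.bound (2 * M / c)).+1)%:R).
    by rewrite -[leRHS]natr1 lerD2r ltW // archi_boundP // divr_ge0 ?mulr_ge0 // ltW.
  by rewrite ler_nat; apply: leq_trans jn; rewrite /j; lia.
have jc : 2 <= j%:R * c by rewrite -ler_pdivrMr.
have xc : 2 * M + c <= (n j)%:R * c.
  move: bound2; rewrite -lerBrDr ler_pdivrMr // mulrBl mul1r => xc; lra.
have fx : j%:R * (f (n j))%:R <= (n j)%:R ^+ 2 :> F.
  by rewrite -natrM -natrX ler_nat.
have f0 : 0 <= (f (n j))%:R :> F by rewrite ler0n.
have qle : c * (n j)%:R ^+ 2 <= (f (n j))%:R + M.
  apply: le_trans (cN _ _) _; first by apply: leq_trans jn; rewrite /j; lia.
  have -> : q.[(n j)%:R] = (f (n j))%:R - sigma (n j).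
    by rewrite qE ?addrK // /j; lia.
  by apply: le_trans (ler_normB _ _) _; rewrite ger0_norm // lerD2l.
move: x1 jc xc fx f0 qle; move: (n j)%:R (f (n j))%:R j%:R => x y t x1 tc xc ty y0 cx.
have x0 : 0 <= x by apply: le_trans x1.
have xxc : 0 <= (x - 1) * (x * c) by rewrite mulr_ge0 ?subr_ge0 ?mulr_ge0 // ltW.
have ycx : 0 <= (t * c - 2) * y by rewrite mulr_ge0 ?subr_ge0.
have ctyx : 0 <= c * (x ^+ 2 - t * y) by rewrite mulr_ge0 ?subr_ge0 // ltW.
clear -x1 xc xxc ycx ctyx cx c0 M0 y0; nra.
Qed.

End QuasiPolynomialGrowth.

(** * The valuation of the curve *)

Section CurveValuation.
Variable F : realType.
Local Notation A := {poly {poly rat}}.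
Local Notation R := (localization (origin rat)).
Local Notation iota := (loc_embed (origin rat)).
Local Notation co := (@curve_coef F).
Local Notation vge := (@vanishes_below F).
Implicit Types (f g a b : A) (z w : R).

Definition curve_order f : nat :=
  if pselect (exists s, co f s != 0) is left ex then ex_minn ex else 0%N.

Lemma curve_order_spec f : f != 0 -> vge (curve_order f) f /\ co f (curve_order f) != 0.
Proof.
move=> /(curve_coef_neq0 F) ex; rewrite /curve_order; case: pselect => // ex'.
case: ex_minnP => m fm mmin; split=> // s sm; apply/eqP.
by apply: contraTT sm => /mmin; rewrite -leqNgt.
Qed.

Lemma vge_order f n : f != 0 -> vge n f <-> (n <= curve_order f)%N.
Proof.
move=> /curve_order_spec[vf cf]; split=> [fn|nf]; last exact: vanishes_below_le nf vf.
by rewrite leqNgt; apply: contraNN cf => /fn ->.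
Qed.

Lemma curve_order_unique f n : vge n f -> co f n != 0 -> curve_order f = n.
Proof.
move=> fn cfn; have f0 : f != 0.
  by apply: contraNneq cfn => ->; rewrite /curve_coef rmorph0 coef0.
have [vf cf] := curve_order_spec f0; apply/eqP; rewrite eqn_leq; apply/andP; split.
  by rewrite leqNgt; apply: contraNN cfn => /vf ->.
by apply/vge_order.
Qed.

Lemma curve_orderM f g : f != 0 -> g != 0 ->
  curve_order (f * g) = (curve_order f + curve_order g)%N.
Proof.
move=> /curve_order_spec[vf cf] /curve_order_spec[vg cg]; apply: curve_order_unique.
  exact: vanishes_belowM.
by rewrite curve_coef_lead // mulf_neq0.
Qed.

Lemma co0_origin b : co b 0 = ratr (origin rat b).
Proof. by rewrite curve_coef_at0. Qed.

Lemma curve_order_unit b : origin rat b != 0 -> curve_order b = 0%N.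
Proof. by move=> b0; apply: curve_order_unique => //; rewrite co0_origin fmorph_eq0. Qed.

Lemma origin_neq0 b : origin rat b != 0 -> b != 0.
Proof. by apply: contra_neq => ->; rewrite rmorph0. Qed.

Lemma co_x s : co 'X%:P s = (s == 1)%:R.
Proof. by rewrite /curve_coef evC /= map_polyX coefX. Qed.

Definition loc_num z : A := projT1 (cid (locP z)).
(** Denominators do not vanish at the origin and so have order 0: the numerator alone determines the
    order. *)
Definition loc_order z : nat := curve_order (loc_num z).

Lemma loc_orderE z a b : a != 0 -> origin rat b != 0 -> z * iota b = iota a ->
  loc_order z = curve_order a.
Proof.
move=> a0 b0 zE; rewrite /loc_order /loc_num; case: (cid (locP z)) => c /= [d [d0 zE']].
have cross : c * b = a * d.
  by apply: (@loc_embed_inj _ _ (origin rat)); rewrite !rmorphM /= -zE -zE' mulrAC.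
have c0 : c != 0.
  apply: contraTneq (mulf_neq0 a0 (origin_neq0 d0)) => c0.
  by rewrite -cross c0 mul0r eqxx.
have := congr1 curve_order cross.
rewrite (curve_orderM c0 (origin_neq0 b0)) (curve_orderM a0 (origin_neq0 d0)).
by rewrite (curve_order_unit b0) (curve_order_unit d0) !addn0.
Qed.

Lemma loc_fracP z : z != 0 -> exists a b, [/\ a != 0, origin rat b != 0 & z * iota b = iota a].
Proof.
move=> z0; have [a [b [b0 zE]]] := locP z; exists a, b; split=> //.
apply: contra_neq z0 => a0; apply: (mulIr (loc_embed_unit b0)).
by rewrite zE a0 rmorph0 mul0r.
Qed.

Lemma loc_orderM z w : z != 0 -> w != 0 -> loc_order (z * w) = (loc_order z + loc_order w)%N.
Proof.
move=> /loc_fracP[a [b [a0 b0 zE]]] /loc_fracP[c [d [c0 d0 wE]]].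
rewrite (loc_orderE a0 b0 zE) (loc_orderE c0 d0 wE) -curve_orderM //.
apply: (loc_orderE (b := b * d)); rewrite ?mulf_neq0 //; first by rewrite rmorphM mulf_neq0.
by rewrite !rmorphM /= -zE -wE mulrACA.
Qed.

Lemma loc_orderD z w : z != 0 -> w != 0 -> z + w != 0 ->
  (minn (loc_order z) (loc_order w) <= loc_order (z + w)%R)%N.
Proof.
move=> /loc_fracP[a [b [a0 b0 zE]]] /loc_fracP[c [d [c0 d0 wE]]] zw0.
have bd0 : origin rat (b * d) != 0 by rewrite rmorphM mulf_neq0.
have sE : (z + w) * iota (b * d) = iota (a * d + c * b).
  by rewrite rmorphD !rmorphM /= -zE -wE; ring.
have s0 : a * d + c * b != 0.
  apply: contra_neq zw0 => s0; apply: (mulIr (loc_embed_unit bd0)).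
  by rewrite sE s0 rmorph0 mul0r.
rewrite (loc_orderE a0 b0 zE) (loc_orderE c0 d0 wE) (loc_orderE s0 bd0 sE).
have [va _] := curve_order_spec a0; have [vc _] := curve_order_spec c0.
apply/vge_order => //; apply: vanishes_belowD.
  by rewrite -[minn _ _]addn0; apply: vanishes_belowM => //;
    apply: vanishes_below_le (geq_minl _ _) va.
by rewrite -[minn _ _]addn0; apply: vanishes_belowM => //;
    apply: vanishes_below_le (geq_minr _ _) vc.
Qed.

Lemma loc_order_x : loc_order (iota 'X%:P) = 1%N.
Proof.
rewrite (@loc_orderE _ 'X%:P 1) ?rmorph1 ?mulr1 ?oner_neq0 ?polyC_eq0 ?polyX_eq0 //.
by apply: curve_order_unique => [[|//] _|]; rewrite co_x ?oner_neq0.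
Qed.

Definition curve_valuation : discrete_valuation {fraction R} :=
  order_valuation loc_orderM loc_orderD (iota_x_neq0 rat) loc_order_x.

Lemma mem_curve_ideal n z a b : origin rat b != 0 -> z * iota b = iota a ->
  (z \in valuation_ideal curve_valuation n) <-> vge n a.
Proof.
move=> b0 zE; rewrite inE; have [a0|a0] := eqVneq a 0.
  have -> : z = 0 by apply: (mulIr (loc_embed_unit b0)); rewrite zE a0 rmorph0 mul0r.
  rewrite tofrac0 val_zero leey a0; split=> // _ s _.
  by rewrite /curve_coef rmorph0 coef0.
have z0 : z != 0.
  apply: contra_neq a0 => z0; apply: (@loc_embed_inj _ _ (origin rat)).
  by rewrite -zE z0 mul0r rmorph0.
rewrite order_valuationE // (loc_orderE a0 b0 zE) lee_fin lez_nat.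
by split=> [|/vge_order]; [move/vge_order; apply | apply].
Qed.

Lemma curve_dominates : dominates curve_valuation (loc_max (origin rat)).
Proof.
have mem0 z : tofrac z \in valuation_ring curve_valuation.
  rewrite inE; have [->|z0] := eqVneq z 0; first by rewrite tofrac0 val_zero leey.
  by rewrite order_valuationE // lee_fin.
split=> // z; have [a [b [b0 zE]]] := locP z.
rewrite !inE (loc_unitE b0 zE) negbK.
(* Values are integers or +oo, so domination reduces to I_1, which only tests the constant term. *)
have -> : (0 < curve_valuation (tofrac z))%E = (1%:Z%:E <= curve_valuation (tofrac z))%E.
  have [->|z0] := eqVneq z 0; first by rewrite tofrac0 val_zero ltey leey.
  by rewrite order_valuationE // lee_fin lte_fin.
have := mem_curve_ideal 1 b0 zE; rewrite inE => ->.
split=> [/eqP a0 [|//] _|/(_ 0%N isT)].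
  by rewrite co0_origin a0 rmorph0.
by rewrite co0_origin => /eqP; rewrite fmorph_eq0.
Qed.

Local Notation I n := (valuation_ideal curve_valuation n).

Lemma curve_ideal_submod n : submod_closed (I n).
Proof. exact: valuation_ideal_submod curve_dominates n. Qed.

(** * Upper bound for the length *)

Definition loc_scalar : {rmorphism rat -> R} := iota \o (polyC \o polyC).

Lemma common_denominator (J : finType) (z : J -> R) : exists b (a : J -> A),
  origin rat b != 0 /\ forall j, z j * iota b = iota (a j).
Proof.
have ex j : exists ab : A * A, origin rat ab.2 != 0 /\ z j * iota ab.2 = iota ab.1.
  by have [a [b [b0 zE]]] := locP (z j); exists (a, b).
have [ab abP] := choice ex; exists (\prod_j (ab j).2).
exists (fun j => (ab j).1 * \prod_(i | i != j) (ab i).2); split.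
  by rewrite rmorph_prod; apply/prodf_neq0 => j _; case: (abP j).
by move=> j; rewrite (bigD1 j) //= !rmorphM mulrA; have [_ ->] := abP j.
Qed.

(* An element of R modulo I n is determined by n coefficients in the field L_j, whose degree over
   the rationals is at most 2 ^ j. *)
Lemma curve_dependence j n (z : 'I_(n * 2 ^ j).+1 -> R) : (n <= gap_exponent F j)%N ->
  exists u : 'I_(n * 2 ^ j).+1 -> rat,
    (exists i, u i != 0) /\ \sum_i loc_scalar (u i) *: (z i : R^o) \in I n.
Proof.
move=> nj; have [b [a [b0 zE]]] := common_denominator z.
have [w wP] := tower_span F j.
have ex i : exists C : 'M[rat]_(n, 2 ^ j),
    forall s : 'I_n, co (a i) s = \sum_t ratr (C s t) * w t.
  have exs (s : 'I_n) : exists c : 'I_(2 ^ j) -> rat, co (a i) s = \sum_t ratr (c t) * w t.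
    by apply/wP/curve_coef_tower; apply: leq_trans (ltn_ord s) nj.
  have [c cP] := choice exs; exists (\matrix_(s, t) c s t) => s; rewrite cP.
  by apply: eq_bigr => t _; rewrite mxE.
have [C CP] := choice ex.
(* Each row lists the rational coordinates of one numerator; with one more row than columns the left
   kernel is nonzero. *)
pose M : 'M[rat]_((n * 2 ^ j).+1, n * 2 ^ j) := \matrix_i mxvec (C i).
have : kermx M != 0.
  rewrite kermx_eq0 /row_free neq_ltn; apply/orP; left.
  exact: leq_ltn_trans (rank_leq_col M) (ltnSn _).
case/rowV0Pn => u /sub_kermxP uM /rV0Pn[i0 ui0].
exists (u 0); split; first by exists i0.
have dep s t : \sum_i u 0 i * C i s t = 0.
  have := congr1 (fun v : 'rV_(n * 2 ^ j) => v 0 (mxvec_index s t)) uM.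
  rewrite mxE [RHS]mxE => uM0; rewrite -[RHS]uM0; apply: eq_bigr => i _.
  by rewrite mxE mxvecE.
pose q i : A := (u 0 i)%:P%:P.
apply/(@mem_curve_ideal n _ (\sum_i q i * a i) b b0).
  rewrite mulr_suml rmorph_sum; apply: eq_bigr => i _.
  by rewrite rmorphM /= -zE mulrA.
move=> s sn; rewrite curve_coef_sum.
under eq_bigr => i _ do rewrite curve_coef_const (CP i (Ordinal sn)) mulr_sumr.
rewrite exchange_big big1 // => t _ /=.
under eq_bigr => i _ do rewrite mulrA -rmorphM.
by rewrite -mulr_suml -rmorph_sum dep rmorph0 mul0r.
Qed.

(** * Lower bound for the length *)

Lemma co_xn k s : co ('X%:P ^+ k) s = (s == k)%:R.
Proof. by rewrite /curve_coef -polyC_exp evC /= map_polyXn coefXn. Qed.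

Lemma lead_coef_shift j : exists N, forall s, (N <= s)%N ->
  exists f, [/\ vge s f, tower j.+1 (co f s) & ~ tower j (co f s)].
Proof.
have [f [e [_ fe fL fnL]]] := new_lead_coef F j; exists e => s es.
have xv : vge (s - e) ('X%:P ^+ (s - e)).
  by move=> t ts; rewrite co_xn ltn_eqF.
exists ('X%:P ^+ (s - e) * f).
have sE : s = (s - e + e)%N by rewrite subnK.
have -> : co ('X%:P ^+ (s - e) * f) s = co f e.
  by rewrite {2}sE curve_coef_lead // co_xn eqxx mul1r.
by split=> //; rewrite {1}sE; apply: vanishes_belowM.
Qed.

(** For fixed [s] these ideals increase with [j] between I_(s+1) and I_s, and so refine the
    filtration by the valuation ideals. *)
Definition step_ideal s j : {pred R} := fun z =>
  `[< exists a b, [/\ origin rat b != 0, z * iota b = iota a, vge s a & tower j (co a s)] >].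

(** On elements of order at least [s], multiplication by r multiplies the coefficient of t^s by the
    value of r at the origin, which is rational and thus in every L_j. *)
Lemma step_ideal_submod s j : submod_closed (step_ideal s j : {pred R^o}).
Proof.
split.
  apply/asboolP; exists 0, 1; rewrite mul0r !rmorph0 rmorph1 oner_neq0.
  by split=> // [t _|]; rewrite /curve_coef rmorph0 coef0 //; apply: tower0.
change (forall r : R, {in step_ideal s j &, forall u v : R, r * u + v \in step_ideal s j}).
move=> r u v /asboolP[a [b [b0 uE va La]]] /asboolP[c [d [d0 vE vc Lc]]].
have [e [f [f0 rE]]] := locP r.
apply/asboolP; exists (e * d * a + f * b * c), (f * b * d); split.
- by rewrite !rmorphM !mulf_neq0.
- by rewrite !(rmorphD, rmorphM) /= -uE -vE -rE; ring.
- by apply: vanishes_belowD; rewrite -[s]add0n; apply: vanishes_belowM.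
have L0 g : tower j (co g 0) by rewrite co0_origin; apply: tower_rat.
rewrite curve_coefD -[s]add0n !curve_coef_lead //.
by apply: towerD; apply: towerM.
Qed.

Lemma step_ideal_embed s j f : vge s f -> (iota f \in step_ideal s j) <-> tower j (co f s).
Proof.
move=> vf; split=> [/asboolP[a [b [b0 fE va La]]]|Lf]; last first.
  by apply/asboolP; exists f, 1; rewrite !rmorph1 mulr1 oner_neq0; split.
have aE : f * b = a by apply: (@loc_embed_inj _ _ (origin rat)); rewrite rmorphM.
move: La; rewrite -aE -[s in co _ s]addn0 curve_coef_lead // co0_origin => La.
have b0' : ratr (origin rat b) != 0 :> F by rewrite fmorph_eq0.
rewrite -(mulfK b0' (co f s)); apply: towerM => //.
by apply/towerV/tower_rat.
Qed.

Lemma curve_ideal_step s m j : (s < m)%N -> {subset I m <= step_ideal s j}.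
Proof.
move=> sm z zI; have [a [b [b0 zE]]] := locP z.
have va : vge m a by apply/(mem_curve_ideal m b0 zE).
apply/asboolP; exists a, b; split=> //; first exact: vanishes_below_le (ltnW sm) va.
by rewrite va //; apply: tower0.
Qed.

(** The same [f] witnesses both strict inclusions: one level up at order [s], and down to level 0 at
    any smaller order [t], where its coefficient is 0. *)
Lemma step_ideal_strict s j f : vge s f -> tower j.+1 (co f s) -> ~ tower j (co f s) ->
  ({subset step_ideal s j <= step_ideal s j.+1} /\
     ~ {subset step_ideal s j.+1 <= step_ideal s j}) /\
  forall t, (t < s)%N ->
    {subset step_ideal s j <= step_ideal t 0} /\
      ~ {subset step_ideal t 0 <= step_ideal s j}.
Proof.
move=> vf Lf nLf; split; [|move=> t ts]; split.
- move=> z /asboolP[a [b [b0 zE va La]]]; apply/asboolP; exists a, b; split=> //.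
  exact: towerS.
- by move/(_ (iota f)) => sub; apply: nLf; apply/(step_ideal_embed _ vf)/sub/step_ideal_embed.
- move=> z /asboolP[a [b [b0 zE va La]]]; apply/asboolP; exists a, b; split=> //.
    exact: vanishes_below_le (ltnW ts) va.
  by rewrite va //; apply: tower0.
- move/(_ (iota f)) => sub; apply: nLf; apply/(step_ideal_embed _ vf)/sub.
  apply/step_ideal_embed; first exact: vanishes_below_le (ltnW ts) vf.
  by rewrite vf //; apply: tower0.
Qed.

Lemma curve_long_chain C : exists N, forall m,
  has_strict_chain (fun J : {pred R^o} => submod_closed J /\ {subset I m <= J})
    (C * (m - N)).
Proof.
have [N0 N0P] := choice lead_coef_shift.
exists (\max_(j < C) N0 j).+1 => m; set N := _.+1.
have lead j s : (j < C)%N -> (N <= s.+1)%N ->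
    exists f, [/\ vge s f, tower j.+1 (co f s) & ~ tower j (co f s)].
  by move=> jC Ns; apply: N0P; apply: leq_trans (leq_bigmax (Ordinal jC)) Ns.
have [->|C0] := posnP C.
  by exists (fun=> I m); split=> // i _; split=> //; apply: curve_ideal_submod.
have [mN|Nm] := leqP m N.
  rewrite (eqP mN) muln0.
  by exists (fun=> I m); split=> // i _; split=> //; apply: curve_ideal_submod.
(* The quotient of [l] by [C] lowers the order from m - 1 and the remainder is the level, so each of
   the m - N orders contributes [C] inclusions. *)
exists (fun l => step_ideal (m.-1 - l %/ C) (l %% C)); split=> [l _|l lL].
  split; [exact: step_ideal_submod | apply: curve_ideal_step].
  by rewrite (leq_ltn_trans (leq_subr _ _)) // ltn_predL (leq_ltn_trans _ Nm).
have lq : (l %/ C < m - N)%N by rewrite ltn_divLR // mulnC.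
have lr : (l %% C < C)%N by rewrite ltn_mod.
have bounds q n : (q < m - n)%N -> (n < m)%N -> (0 < n)%N ->
    (n <= (m.-1 - q).+1)%N /\ (m.-1 - q.+1 < m.-1 - q)%N by lia.
have [Ns ms] := bounds _ _ lq Nm isT.
have [f [vf Lf nLf]] := lead (l %% C)%N (m.-1 - l %/ C)%N lr Ns.
have [same next] := step_ideal_strict vf Lf nLf.
have lE := divn_eq l C.
have [lt_r|] := ltnP (l %% C).+1 C.
  have -> : (l.+1 %/ C = l %/ C)%N by rewrite {1}lE -addnS divnMDl // (divn_small lt_r) addn0.
  by have -> : (l.+1 %% C = (l %% C).+1)%N by rewrite {1}lE -addnS modnMDl modn_small.
move=> ge_r; have rE : (l %% C).+1 = C by apply/eqP; rewrite eqn_leq ge_r lr.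
have l1E : l.+1 = ((l %/ C).+1 * C)%N by rewrite {1}lE -addnS rE mulSn addnC.
have -> : (l.+1 %/ C = (l %/ C).+1)%N by rewrite l1E mulnK.
have -> : (l.+1 %% C = 0)%N by rewrite l1E modnMl.
exact: next.
Qed.

Lemma curve_length_exists n : exists l,
  module_length (quot_module (valuation_ideal_submod curve_dominates n)) l.
Proof.
apply: (@max_chain_exists _ _ (n * 2 ^ n)).
  by exists (fun=> true); split.
move=> l /quot_strict_chain; apply: (strict_chain_bound (s := loc_scalar)).
by move=> z; apply: curve_dependence; apply/ltnW/gap_exponent_gt.
Qed.

End CurveValuation.

Theorem theorem1p3 (F : realType) :
  exists (R : idomainType) (m : {pred R}),
    regular_local_ring m 2 /\
    exists (nu : discrete_valuation {fraction R}) (nuR : dominates nu m)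
           (ell : nat -> nat),
      (forall n : nat,
         module_length (quot_module (valuation_ideal_submod nuR n)) (ell n)) /\
      ~ eventually_quasi_polynomial_plus_bounded
          (fun n => (ell n)%:R : F).
Proof.
exists (localization (origin rat)), (loc_max (origin rat)).
split; first exact: local_ring_regular.
exists (curve_valuation F), (curve_dominates F).
have [ell ellP] := choice (curve_length_exists F); exists ell; split=> //.
apply: (@not_quasi_polynomial F ell (gap_exponent F)).
- exact: gap_exponent_incr.
- exact: gap_exponent_dvd.
- move=> j.
  (* Together with j 2^j <= [gap_exponent F j], this gives the required quadratic bound. *)
  have ell_le : (ell (gap_exponent F j) <= gap_exponent F j * 2 ^ j)%N.
    have [/quot_strict_chain chain _] := ellP (gap_exponent F j).
    apply: (strict_chain_bound (s := loc_scalar) _ chain) => z.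
    exact: curve_dependence.
  have := gap_exponent_ge F j; rewrite expnS expn1 => e_ge.
  apply: leq_trans (leq_mul (leqnn j) ell_le) _; rewrite mulnCA leq_mul2l.
  by apply/orP; right; apply: leq_trans e_ge; lia.
- move=> C; have [N NP] := curve_long_chain F C; exists N => m.
  have : (C * (m - N) <= ell m)%N.
    by apply: (ellP m).2; apply/quot_strict_chain.
  by rewrite mulnBr; lia.
Qed.
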